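(* Let $\lambda_{1,L}(\sigma)$, for $\sigma\in(0,1)$, be the first (smallest) eigenvalue of the Laplace operator with vanishing Dirichlet traces on the annulus $\Omega^*_\sigma$, and let $\lambda_{1,L}(o)$ be the first eigenvalue of the Laplace operator with vanishing Dirichlet traces on the open unit ball $\Omega^*$. Then $$\lim_{\sigma\to 0}\lambda_{1,L}(\sigma)=\lambda_{1,L}(o).$$
   Context: $\Omega^*:=\{\underline{x}\in\mathbb{R}^3:\ \|\underline{x}\|<1\}$ and, for $\sigma\in(0,1)$, $\Omega^*_\sigma:=\{\underline{x}\in\mathbb{R}^3:\ \sigma<\|\underline{x}\|<1\}$, where $\|\cdot\|$ is the Euclidean norm; the limit is the right-hand limit at $0$. For $\Omega\in\{\Omega^*,\Omega^*_\sigma\}$ the Laplace operator on $\Omega$ is the Friedrichs extension in $L_2(\Omega)$ of $v\mapsto-\Delta v$ defined on $C_0^\infty(\Omega)$; its domain is $\mathring{W}_2^1(\Omega)\cap W_2^2(\Omega)$, where $W_2^k(\Omega)$ is the usual Sobolev space of order $k$ based on $L_2$ and $\mathring{W}_2^1(\Omega)$ is the closure of $C_0^\infty(\Omega)$ in $W_2^1(\Omega)$. This is the negative Dirichlet Laplacian, a positive self-adjoint operator with compact inverse and hence with pure point spectrum. For $\Omega^*_\sigma$ zero Dirichlet conditions are imposed on both boundary spheres $\|\underline{x}\|=\sigma$ and $\|\underline{x}\|=1$. *)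

(* Defs.v *)
From HB Require Import structures.
From mathcomp Require Import all_boot all_order all_algebra.
From mathcomp Require Import all_classical all_reals all_analysis.

Set Implicit Arguments.
Unset Strict Implicit.
Unset Printing Implicit Defensive.

Import Order.TTheory GRing.Theory Num.Theory.
Import numFieldNormedType.Exports.

Local Open Scope classical_set_scope.
Local Open Scope ring_scope.

(** Points of the three-dimensional space are triples [(x1, x2, x3) : R * R * R].
    The product topology is the Euclidean one, but the library norm of a product
    is the maximum norm, hence [enorm]. *)

Section space.
Context {R : realType}.
Local Notation R3 := (R * R * R)%type.
Local Notation mR3 :=
  (measurableTypeR R * measurableTypeR R * measurableTypeR R)%type.

Definition enorm (x : R3) : R :=
  Num.sqrt (x.1.1 ^+ 2 + x.1.2 ^+ 2 + x.2 ^+ 2).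

Definition ball3 : set R3 := [set x | enorm x < 1].

Definition annulus3 (s : R) : set R3 := [set x | s < enorm x < 1].

(** [measurableTypeR R] is [R] with its Borel sigma-algebra, the type on which the
    library defines the Lebesgue measure. *)
Definition leb3 : {measure set mR3 -> \bar R} :=
  (@lebesgue_measure R \x @lebesgue_measure R \x @lebesgue_measure R)%E.

Definition e3 (i : 'I_3) : R3 := ((i == 0)%:R, (i == 1)%:R, (i == 2)%:R).

Definition laplacian (f : R3 -> R) : R3 -> R :=
  fun x => \sum_(i < 3) 'D_(e3 i) ('D_(e3 i) f) x.

(** [pderiv [:: i; j; ..] f] is the iterated partial derivative
    d_i (d_j (.. f)); the list plays the role of a multi-index. *)
Definition pderiv (s : seq 'I_3) (f : R3 -> R) : R3 -> R :=
  foldr (fun i g => 'D_(e3 i) g) f s.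

(** [derive] is a total function, so the existence of all the iterated partial
    derivatives has to be required on top of their continuity. *)
Definition smooth (f : R3 -> R) : Prop :=
  forall s : seq 'I_3, continuous (pderiv s f) /\
    forall (i : 'I_3) (x : R3), derivable (pderiv s f) x (e3 i).

(** C_0^oo(Omega), each function being extended by zero to the whole space *)
Definition Cc_smooth (Om : set R3) : set (R3 -> R) :=
  [set f | smooth f /\
    exists K : set R3, [/\ compact K, K `<=` Om & forall x, ~ K x -> f x = 0]].

End space.

(** A function on [Om] is represented by any function on the whole space with
    this restriction: its values outside [Om] are irrelevant everywhere below.
    Measurability refers to the Borel sets; every Lebesgue class has a Borel
    representative. *)
Section sobolev.
Context {R : realType}.
Local Notation R3 := (R * R * R)%type.
Local Notation mR3 :=
  (measurableTypeR R * measurableTypeR R * measurableTypeR R)%type.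
Variable Om : set R3.

Definition L2 : set (R3 -> R) :=
  [set u | measurable_fun (Om : set mR3) (u : mR3 -> R) /\
           leb3.-integrable Om (fun x => (u x ^+ 2)%:E)].

Definition ip (u v : R3 -> R) : R := \int[leb3]_(x in Om) (u x * v x).

Definition weak_pderiv (s : seq 'I_3) (u g : R3 -> R) : Prop :=
  forall phi, Cc_smooth Om phi ->
    ip u (pderiv s phi) = (-1) ^+ size s * ip g phi.

(** W_2^k(Omega) *)
Definition W2 (k : nat) : set (R3 -> R) :=
  [set u | L2 u /\ forall s : seq 'I_3, (size s <= k)%N ->
    exists2 g, L2 g & weak_pderiv s u g].

(** The closure of C_0^oo(Omega) in W_2^1(Omega). The family [g] is the weak
    gradient of [u], and the left-hand side of the last inequality is the square
    of the W_2^1 norm of [u - phi]. *)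
Definition W2o1 : set (R3 -> R) :=
  [set u | L2 u /\ exists g : 'I_3 -> R3 -> R,
    (forall i, L2 (g i) /\ weak_pderiv [:: i] u (g i)) /\
    forall eps : R, 0 < eps -> exists2 phi, Cc_smooth Om phi &
      ip (u \- phi) (u \- phi) +
      \sum_(i < 3) ip (g i \- 'D_(e3 i) phi) (g i \- 'D_(e3 i) phi) < eps].

End sobolev.

(** Graph of the Friedrichs extension of a positive symmetric operator [T] with
    dense domain [D] in a space [H] of functions with inner product [dot]: it is
    the restriction of the adjoint of [T] to the vectors of [H] which belong to
    the completion of [D] for the energy norm, i.e. which are limits in [H] of
    sequences of [D] that are Cauchy for the quadratic form v |-> <Tv, v>. *)
Definition friedrichs (X : Type) (R : realType) (H D : set (X -> R))
    (dot : (X -> R) -> (X -> R) -> R) (T : (X -> R) -> X -> R)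
    (u f : X -> R) : Prop :=
  [/\ H u, H f,
      forall v, D v -> dot u (T v) = dot f v &
      exists phi : nat -> X -> R,
        [/\ forall n, D (phi n),
            dot (phi n \- u) (phi n \- u) @[n --> \oo] --> 0 &
            forall eps : R, 0 < eps -> exists N, forall m n,
              (N <= m)%N -> (N <= n)%N ->
              dot (T (phi m \- phi n)) (phi m \- phi n) < eps]].

Section dirichlet_laplacian.
Context {R : realType}.
Local Notation R3 := (R * R * R)%type.
Variable Om : set R3.

(** Graph of the (negative) Laplace operator with vanishing Dirichlet traces:
    the Friedrichs extension of v |-> - Delta v, with its domain spelled out. *)
Definition dirichlet_laplacian (u f : R3 -> R) : Prop :=
  [/\ W2o1 Om u, W2 Om 2 u &
      friedrichs (L2 Om) (Cc_smooth Om) (ip Om)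
        (fun v x => - laplacian v x) u f].

Definition eigenvalue_laplacian (lam : R) : Prop :=
  exists u : R3 -> R,
    ~ {ae leb3, forall x, Om x -> u x = 0} /\
    dirichlet_laplacian u (fun x => lam * u x).

Definition first_eigenvalue_laplacian (lam : R) : Prop :=
  eigenvalue_laplacian lam /\
  forall mu, eigenvalue_laplacian mu -> lam <= mu.

End dirichlet_laplacian.

(* Main.v *)
Require Import Defs.
From HB Require Import structures.
From mathcomp Require Import all_boot all_order all_algebra.
From mathcomp Require Import all_classical all_reals all_analysis.
From mathcomp Require Import measurable_realfun ring lra.
Import Order.TTheory GRing.Theory Num.Theory.
Import numFieldNormedType.Exports.
Local Open Scope classical_set_scope.
Local Open Scope ring_scope.

(** Both eigenvalues are explicit. With r the Euclidean norm, the radial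
    functions sin (pi (r - sigma) / (1 - sigma)) / r on the annulus and
    sin (pi r) / r on the ball are eigenfunctions for (pi / (1 - sigma))^2 and
    pi^2; they are positive, so these are the first eigenvalues, and the limit
    is the continuity of (pi / (1 - sigma))^2 at 0.

    The principle that a positive eigenfunction belongs to the first eigenvalue
    is [first_eigenvalue_of_positive]: on a bounded open set [Om] let [h] be
    smooth and positive with - Delta h = lam h, with bounded derivatives of
    order at most 2, and with compact superlevel sets.

    - No eigenvalue lies below [lam]. For a test function v, the difference
      v (- Delta v) - lam v^2 is |grad v - (v / h) grad h|^2 plus the divergence
      of a compactly supported field ([picone]), so the form of - Delta - lam is
      nonnegative on test functions. An eigenfunction of the Friedrichs
      extension is a limit of test functions that are Cauchy for the form,
      hence its eigenvalue is at least [lam] ([eigenvalue_ge]).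
    - [lam] is an eigenvalue, with eigenfunction [h] ([eigenvalue_lam]). The
      test functions h E(n h - 1), where E(t) = exp (-1/t) for t > 0 and 0
      otherwise, converge to [h] with their gradients by dominated convergence;
      the weak derivatives of [h] are the classical ones.

    Both halves rest on integration by parts against test functions
    ([Cc_ibp]), which comes from the fundamental theorem of calculus on lines
    and Fubini's theorem ([integral_pderiv]).

    A function of the form g(r^2) has Laplacian 4 q g''(q) + 6 g'(q) at
    q = r^2, which reduces the examples to one variable
    ([radial_first_eigenvalue]). On the ball the profile sin (pi r) / r has to be
    smooth across the origin: it is an entire power series in r^2
    ([smooth1_pseries], [sinc_profile]). *)

Set Implicit Arguments.
Unset Strict Implicit.
Unset Printing Implicit Defensive.

(** * Smooth functions on open sets of the space *)

Section calculus.
Context {R : realType}.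
Local Notation R3 := (R * R * R)%type.
Implicit Types (f g : R3 -> R) (U : set R3) (x v : R3).

(** A directional derivative only sees the restriction to a line, so the chain
    rule and all later computations reduce to one variable. *)
Lemma is_derive_line f x v d :
  is_derive (0 : R) 1 (fun t : R => f (t *: v + x)) d -> is_derive x v f d.
Proof.
move=> [fd <-]; apply: DeriveDef; first exact/derivable1P.
rewrite /derive; set g1 := fun h => h^-1 *: _; set g2 := fun h => h^-1 *: _.
suff -> : g1 = g2 by [].
by apply/funext => t; rewrite /g1 /g2 /= addr0 scale0r add0r [_%:A]mulr1.
Qed.

Lemma line_is_derive f x v d :
  is_derive x v f d -> is_derive (0 : R) 1 (fun t : R => f (t *: v + x)) d.
Proof.
move=> [fd <-]; apply: DeriveDef; first by case: (derivable1P f x v) => + _; apply.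
rewrite /derive; set g1 := fun h => h^-1 *: _; set g2 := fun h => h^-1 *: _.
suff -> : g1 = g2 by [].
by apply/funext => t; rewrite /g1 /g2 /= addr0 scale0r add0r [_%:A]mulr1.
Qed.

Lemma is_derive_chain (F : R -> R) f x v a b :
  is_derive (f x) 1 F a -> is_derive x v f b ->
  is_derive x v (F \o f) (a * b).
Proof.
move=> Fa /line_is_derive fb; apply: is_derive_line.
have Fa' : is_derive (f (0 *: v + x)) 1 F a by rewrite scale0r add0r.
exact: (@is_derive1_comp _ F (fun t : R => f (t *: v + x)) 0 a b Fa' fb).
Qed.

Lemma is_derive_coord1 x v : is_derive x v (fun y : R3 => y.1.1) v.1.1.
Proof.
apply: is_derive_line; rewrite /=.
by apply: is_derive_eq; rewrite scaler0 add0r addr0 [_%:A]mulr1.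
Qed.

Lemma is_derive_coord2 x v : is_derive x v (fun y : R3 => y.1.2) v.1.2.
Proof.
apply: is_derive_line; rewrite /=.
by apply: is_derive_eq; rewrite scaler0 add0r addr0 [_%:A]mulr1.
Qed.

Lemma is_derive_coord3 x v : is_derive x v (fun y : R3 => y.2) v.2.
Proof.
apply: is_derive_line; rewrite /=.
by apply: is_derive_eq; rewrite scaler0 add0r addr0 [_%:A]mulr1.
Qed.

Lemma deriveM_fun f g x v : derivable f x v -> derivable g x v ->
  'D_v (fun y => f y * g y) x = f x * 'D_v g x + g x * 'D_v f x.
Proof. by move=> fx gx; rewrite -[RHS](deriveM fx gx). Qed.

Lemma deriveD_fun f g x v : derivable f x v -> derivable g x v ->
  'D_v (fun y => f y + g y) x = 'D_v f x + 'D_v g x.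
Proof. by move=> fx gx; rewrite -[RHS](deriveD fx gx). Qed.

Lemma derivableM_fun f g x v : derivable f x v -> derivable g x v ->
  derivable (fun y => f y * g y) x v.
Proof. by move=> fx gx; exact: (derivableM fx gx). Qed.

Lemma derivableD_fun f g x v : derivable f x v -> derivable g x v ->
  derivable (fun y => f y + g y) x v.
Proof. by move=> fx gx; exact: (derivableD fx gx). Qed.

Lemma open_near U x (P : R3 -> Prop) : open U -> U x ->
  (forall y, U y -> P y) -> \forall y \near x, P y.
Proof.
by move=> oU Ux UP; apply: (filterS UP); apply: open_nbhs_nbhs; split.
Qed.

Lemma pderiv_rcons s i f : pderiv (rcons s i) f = pderiv s ('D_(e3 i) f).
Proof. by rewrite /pderiv -cats1 foldr_cat. Qed.

(** The local version of [smooth]. A test function is glued from its smooth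
    expression on the domain and the zero function off its support. *)
Definition smooth_on U f := forall s : seq 'I_3,
  (forall x, U x -> {for x, continuous (pderiv s f)}) /\
  forall (i : 'I_3) x, U x -> derivable (pderiv s f) x (e3 i).

(** The recursion takes off the innermost derivative. Closure under products and
    compositions goes by induction on the order in this form: the derivative
    of a product is a sum of products of lower order. *)
Fixpoint Ck (k : nat) U f : Prop :=
  (forall x, U x -> {for x, continuous f}) /\
  if k is k'.+1 then forall i : 'I_3,
    (forall x, U x -> derivable f x (e3 i)) /\ Ck k' U ('D_(e3 i) f)
  else True.

Lemma smooth_onE f : smooth f <-> smooth_on setT f.
Proof.
split=> sf s; have [sf1 sf2] := sf s; split.
- by move=> x _; exact: sf1.
- by move=> i x _; exact: sf2.
- by move=> x; exact: sf1.
- by move=> i x; exact: sf2.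
Qed.

Lemma smooth_on_D U f i : smooth_on U f -> smooth_on U ('D_(e3 i) f).
Proof. by move=> sf s; rewrite -pderiv_rcons; exact: sf. Qed.

Lemma smooth_onP U f : smooth_on U f <-> forall k, Ck k U f.
Proof.
split=> [sf k|Cf s].
  elim: k f sf => [|k IH] f sf; have [sf1 sf2] := sf [::]; split => // i.
  by split; [exact: sf2|apply: IH; exact: smooth_on_D].
elim/last_ind: s f Cf => [|s i IH] f Cf.
  split; first by have [] := Cf 0%N.
  by move=> i; have [_ /(_ i)[]] := Cf 1%N.
rewrite pderiv_rcons; apply: IH => k.
by have [_ /(_ i)[]] := Cf k.+1.
Qed.

Lemma CkS k U f : Ck k.+1 U f -> Ck k U f.
Proof.
elim: k f => [|k IH] f; first by case.
move=> [cf df]; split => // i; have [dfi Cdf] := df i; split => //.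
exact: IH.
Qed.

Lemma continuous_at_eq U f g x : open U -> U x ->
  (forall y, U y -> f y = g y) ->
  {for x, continuous f} -> {for x, continuous g}.
Proof.
move=> oU Ux fg cf; suff: g @ x --> g x by [].
rewrite -fg//; apply: cvg_trans cf; apply: near_eq_cvg.
by apply: open_near Ux _ => // y Uy; rewrite fg.
Qed.

Lemma Ck_eq k U f g : open U -> (forall x, U x -> f x = g x) ->
  Ck k U f -> Ck k U g.
Proof.
move=> oU; elim: k f g => [|k IH] f g fg [cf df].
  by split => // x Ux; exact: (continuous_at_eq oU Ux fg (cf _ Ux)).
split=> [x Ux|i]; first exact: (continuous_at_eq oU Ux fg (cf _ Ux)).
have [dfi Cdf] := df i; split=> [x Ux|].
  by apply: near_eq_derivable (dfi _ Ux); apply: open_near Ux _.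
apply: IH Cdf => x Ux; apply: near_eq_derive.
exact: open_near Ux _.
Qed.

Lemma CkD k U f g : open U -> Ck k U f -> Ck k U g ->
  Ck k U (fun x => f x + g x).
Proof.
move=> oU; elim: k f g => [|k IH] f g [cf df] [cg dg].
  by split => // x Ux; apply: cvgD; [exact: cf|exact: cg].
split=> [x Ux|i]; first by apply: cvgD; [exact: cf|exact: cg].
have [dfi Cdf] := df i; have [dgi Cdg] := dg i; split=> [x Ux|].
  by apply: derivableD_fun; [exact: dfi|exact: dgi].
apply: Ck_eq (IH _ _ Cdf Cdg) => // x Ux.
by rewrite deriveD_fun//; [exact: dfi|exact: dgi].
Qed.

Lemma CkM k U f g : open U -> Ck k U f -> Ck k U g ->
  Ck k U (fun x => f x * g x).
Proof.
move=> oU; elim: k f g => [|k IH] f g [cf df] [cg dg].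
  by split => // x Ux; apply: cvgM; [exact: cf|exact: cg].
split=> [x Ux|i]; first by apply: cvgM; [exact: cf|exact: cg].
have [dfi Cdf] := df i; have [dgi Cdg] := dg i; split=> [x Ux|].
  by apply: derivableM_fun; [exact: dfi|exact: dgi].
have Cf : Ck k U f by apply: CkS; split.
have Cg : Ck k U g by apply: CkS; split.
apply: Ck_eq (CkD oU (IH _ _ Cf Cdg) (IH _ _ Cg Cdf)) => // x Ux.
by rewrite deriveM_fun//; [exact: dfi|exact: dgi].
Qed.

(** A witness [D] lists all the derivatives at once; continuity of each of them
    follows from the existence of the next one. *)
Definition smooth1 (V : set R) (F : R -> R) := exists D : nat -> R -> R,
  D 0%N = F /\ forall n t, V t -> is_derive t 1 (D n) (D n.+1 t).

Lemma is_derive1_continuous (F : R -> R) (t a : R) :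
  is_derive t 1 F a -> {for t, continuous F}.
Proof.
by move=> [dF _]; apply: differentiable_continuous; exact/derivable1_diffP.
Qed.

Lemma Ck_comp k U (V : set R) f (D : nat -> R -> R) n : open U ->
  (forall n t, V t -> is_derive t 1 (D n) (D n.+1 t)) ->
  (forall x, U x -> V (f x)) -> Ck k U f -> Ck k U (D n \o f).
Proof.
move=> oU DD UV; elim: k f UV n => [|k IH] f UV n [cf df].
  split => // x Ux; apply: continuous_comp; first exact: cf.
  exact: is_derive1_continuous (DD _ _ (UV _ Ux)).
split=> [x Ux|i].
  apply: continuous_comp; first exact: cf.
  exact: is_derive1_continuous (DD _ _ (UV _ Ux)).
have [dfi Cdf] := df i.
have dc x : U x -> is_derive x (e3 i) (D n \o f) ((D n.+1 \o f) x * 'D_(e3 i) f x).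
  move=> Ux; apply: is_derive_chain; first exact: DD (UV _ Ux).
  exact/derivableP/dfi.
split=> [x Ux|]; first by have [] := dc _ Ux.
have Cf : Ck k U f by apply: CkS; split.
apply: Ck_eq (CkM oU (IH _ UV n.+1 Cf) Cdf) => // x Ux.
by have [_ ->] := dc _ Ux.
Qed.

Lemma Ck_cst k U (a : R) : Ck k U (fun _ => a).
Proof.
elim: k a => [|k IH] a; first by split => // x Ux; exact: cvg_cst.
split=> [x Ux|i]; first exact: cvg_cst.
split=> [x Ux|]; first exact: derivable_cst.
rewrite (_ : 'D_(e3 i) (fun _ => a) = fun _ => 0); first exact: IH.
by apply/funext => x; exact: derive_cst.
Qed.

Lemma smooth_on_eq U f g : open U -> (forall x, U x -> f x = g x) ->
  smooth_on U f -> smooth_on U g.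
Proof.
by move=> oU fg /smooth_onP sf; apply/smooth_onP => k; exact: Ck_eq fg (sf k).
Qed.

Lemma smooth_on_sub U V f : V `<=` U -> smooth_on U f -> smooth_on V f.
Proof.
by move=> VU sf s; have [s1 s2] := sf s; split=> [x /VU|i x /VU];
  [exact: s1|exact: s2].
Qed.

Lemma smooth_onU U V f : smooth_on U f -> smooth_on V f ->
  smooth_on (U `|` V) f.
Proof.
move=> sU sV s; have [s1 s2] := sU s; have [t1 t2] := sV s.
by split=> [x []|i x []]; [exact: s1|exact: t1|exact: s2|exact: t2].
Qed.

Lemma smooth_on_cst U (a : R) : smooth_on U (fun _ => a).
Proof. by apply/smooth_onP => k; exact: Ck_cst. Qed.

Lemma smooth_on_add U f g : open U -> smooth_on U f -> smooth_on U g ->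
  smooth_on U (fun x => f x + g x).
Proof.
by move=> oU /smooth_onP sf /smooth_onP sg; apply/smooth_onP => k; exact: CkD.
Qed.

Lemma smooth_on_mul U f g : open U -> smooth_on U f -> smooth_on U g ->
  smooth_on U (fun x => f x * g x).
Proof.
by move=> oU /smooth_onP sf /smooth_onP sg; apply/smooth_onP => k; exact: CkM.
Qed.

Lemma smooth_on_scale U (a : R) f : open U -> smooth_on U f ->
  smooth_on U (fun x => a * f x).
Proof. by move=> oU sf; apply: smooth_on_mul oU _ sf; exact: smooth_on_cst. Qed.

Lemma smooth_on_opp U f : open U -> smooth_on U f -> smooth_on U (fun x => - f x).
Proof.
by move=> oU sf; under eq_fun do rewrite -mulN1r; exact: smooth_on_scale.
Qed.

Lemma smooth_on_comp U V f F : open U -> smooth1 V F ->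
  (forall x, U x -> V (f x)) -> smooth_on U f -> smooth_on U (F \o f).
Proof.
move=> oU [D [<- DD]] UV /smooth_onP sf; apply/smooth_onP => k.
exact: (Ck_comp (V := V)).
Qed.

Lemma smooth_on_pderiv U f s : smooth_on U f -> smooth_on U (pderiv s f).
Proof.
elim/last_ind: s f => // s i IH f sf; rewrite pderiv_rcons; apply: IH.
exact: smooth_on_D.
Qed.

Lemma smooth_on_continuous U f : smooth_on U f ->
  forall x, U x -> {for x, continuous f}.
Proof. by move=> /(_ [::])[]. Qed.

Lemma smooth_on_derivable U f i : smooth_on U f ->
  forall x, U x -> derivable f x (e3 i).
Proof. by move=> /(_ [::])[_ +] x Ux; apply. Qed.

(** Applied to the coordinates, whose partial derivatives are constant. *)
Lemma smooth_on_linear U f (a : 'I_3 -> R) :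
  (forall x, {for x, continuous f}) ->
  (forall x i, is_derive x (e3 i) f (a i)) -> smooth_on U f.
Proof.
move=> cf df; apply/smooth_onP => -[|k]; split => // i.
split=> [x _|]; first by have [] := df x i.
rewrite (_ : 'D_(e3 i) f = fun _ => a i); first exact: Ck_cst.
by apply/funext => x; have [_ ->] := df x i.
Qed.

Definition sqnorm x : R := x.1.1 ^+ 2 + x.1.2 ^+ 2 + x.2 ^+ 2.

Lemma smooth_on_coord1 U : smooth_on U (fun x => x.1.1).
Proof.
apply: (@smooth_on_linear _ _ (fun i => (e3 i).1.1)) => [x|x i].
  by apply: cvg_comp; exact: cvg_fst.
exact: is_derive_coord1.
Qed.

Lemma smooth_on_coord2 U : smooth_on U (fun x => x.1.2).
Proof.
apply: (@smooth_on_linear _ _ (fun i => (e3 i).1.2)) => [x|x i].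
  by apply: cvg_comp; [exact: cvg_fst|exact: cvg_snd].
exact: is_derive_coord2.
Qed.

Lemma smooth_on_coord3 U : smooth_on U (fun x => x.2).
Proof.
apply: (@smooth_on_linear _ _ (fun i => (e3 i).2)) => [x|x i].
  exact: cvg_snd.
exact: is_derive_coord3.
Qed.

Lemma smooth_on_sqnorm U : open U -> smooth_on U sqnorm.
Proof.
move=> oU; rewrite /sqnorm.
have sX f : smooth_on U f -> smooth_on U (fun x => f x ^+ 2).
  by move=> sf; under eq_fun do rewrite expr2; exact: smooth_on_mul.
apply: (smooth_on_add oU); last exact/sX/smooth_on_coord3.
by apply: (smooth_on_add oU); [exact/sX/smooth_on_coord1|exact/sX/smooth_on_coord2].
Qed.

End calculus.

Section powers.
Context {R : realType}.

(** One family for the square root and the inverses that occur later. *)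
Lemma smooth1_powR (a : R) : smooth1 [set t | 0 < t] (fun t => t `^ a).
Proof.
exists (fun n t => \prod_(i < n) (a - i%:R) * t `^ (a - n%:R)); split.
  by apply/funext => t; rewrite big_ord0 mul1r subr0.
move=> n t t0; have := is_derive1_powR (a - n%:R) t0.
move=> dp; apply: is_derive_eq.
rewrite big_ord_recr /= -[_ *: _]/(_ * _) mulrA; congr (_ * _ `^ _).
by rewrite -natr1; ring.
Qed.

End powers.

(** * A flat cutoff function *)

Section cutoff_function.
Context {R : realType}.

(** The derivative at the gluing point of a function that is flat there. *)
Lemma is_derive0_quadratic (F : R -> R) (C : R) :
  (forall s, `|F s| <= C * s ^+ 2) -> is_derive (0 : R) 1 F 0.
Proof.
move=> FC; have F0 : F 0 = 0.
  by apply/eqP; rewrite -normr_le0; apply: le_trans (FC 0) _; rewrite expr0n mulr0.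
apply/is_derive1_caratheodory; exists (fun z => F z / z); split.
- move=> z; rewrite F0 !subr0; have [->|z0] := eqVneq z 0; first by rewrite F0 mulr0.
  by rewrite divfK.
- apply/cvgrPdist_lt => e e0; rewrite F0 mul0r.
  have C0 : 0 <= C by have := FC 1; rewrite expr1n mulr1; apply: le_trans.
  have d0 : 0 < e / (C + 1) by rewrite divr_gt0//; lra.
  apply/nbhs_ballP; exists (e / (C + 1)) => //= z; rewrite /ball/= sub0r normrN => zd.
  rewrite sub0r normrN normrM normfV.
  have [->|z0] := eqVneq z 0; first by rewrite normr0 invr0 mulr0.
  rewrite ltr_pdivrMr ?normr_gt0//; apply: le_lt_trans (FC z) _.
  rewrite -real_normK ?num_real// expr2 mulrA ltr_pM2r ?normr_gt0//.
  move: zd; rewrite ltr_pdivlMr; last lra.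
  by have := normr_ge0 z; nra.
- by rewrite F0 mul0r.
Qed.

Lemma pow_expRN_le (k : nat) (y : R) : 0 <= y -> y ^+ k * expR (- y) <= k`!%:R.
Proof.
move=> y0; rewrite expRN ler_pdivrMr ?expR_gt0//; case: k => [|k].
  by rewrite expr0 mul1r -expR0 ler_expR.
have := expR_ge1Dxn k y0; rewrite addrC => /(le_trans _) h.
have : y ^+ k.+1 / k.+1`!%:R <= expR y by apply: h; rewrite lerDl.
by rewrite ler_pdivrMr ?ltr0n ?fact_gt0// mulrC.
Qed.

(** The exponential beats every polynomial; with y = 1/s this makes the
    functions Q(1/s) exp (-1/s) flat at 0. *)
Lemma poly_expRN_bounded (Q : {poly R}) :
  exists C, forall y : R, 0 <= y -> `|Q.[y] * expR (- y)| <= C.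
Proof.
exists (\sum_(i < size Q) `|Q`_i| * i`!%:R) => y y0.
rewrite horner_coef mulr_suml; apply: le_trans (ler_norm_sum _ _ _) _.
apply: ler_sum => i _; rewrite -mulrA normrM ler_wpM2l//.
by rewrite ger0_norm ?pow_expRN_le// mulr_ge0 ?expR_ge0// exprn_ge0.
Qed.

(** Derivatives of exp (-1/s) have the form Q(1/s) exp (-1/s) with Q a
    polynomial, and the class is stable: differentiation acts on Q as
    Q |-> X^2 (Q - Q'). *)
Definition cutoff_term (Q : {poly R}) (s : R) : R :=
  if 0 < s then Q.[s^-1] * expR (- s^-1) else 0.

Lemma is_derive_cutoff_term (Q : {poly R}) (s : R) :
  is_derive s 1 (cutoff_term Q) (cutoff_term ('X^2 * (Q - Q^`())) s).
Proof.
have [s0|s0|<-] := ltgtP 0 s.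
- rewrite [X in is_derive _ _ _ X]/cutoff_term s0.
  have s1 : s != 0 by rewrite gt_eqF.
  apply: (@near_eq_is_derive R R R (fun s : R => Q.[s^-1] * expR (- s^-1)) (cutoff_term Q) s 1).
    near=> t; rewrite /cutoff_term ifT//.
    by near: t; exact: lt_nbhsr.
  have di : is_derive s 1 (fun t : R => t^-1) (- s ^- 2).
    by have := is_deriveV s1 (is_derive_id s (1:R)); rewrite [_ *: 1]mulr1.
  have dq : is_derive s^-1 1 (horner Q) Q^`().[s^-1].
    by apply: DeriveDef; [exact: derivable_horner|rewrite derivE derive1E].
  have d1 := @is_derive1_comp _ (horner Q) (fun t => t^-1) s _ _ dq di.
  have d2 : is_derive s 1 (fun t : R => expR (- t^-1)) (expR (- s^-1) * s ^- 2).
    have dn : is_derive s 1 (fun t : R => - t^-1) (s ^- 2).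
      by have := is_deriveN di; rewrite opprK.
    exact: (@is_derive1_comp _ (@expR R) (fun t => - t^-1) s _ _ (is_derive_expR _) dn).
  apply: is_derive_eq (is_deriveM d1 d2) _.
  rewrite !hornerE /= -exprVn -![_ *: _]/(_ * _); ring.
- have -> : cutoff_term ('X^2 * (Q - Q^`())) s = 0 by rewrite /cutoff_term ltNge ltW.
  apply: (@near_eq_is_derive R R R (fun _ : R => 0) (cutoff_term Q) s 1).
  near=> t; rewrite /cutoff_term ltNge ltW//.
  by near: t; exact: lt_nbhsl.
- have -> : cutoff_term ('X^2 * (Q - Q^`())) 0 = 0 by rewrite /cutoff_term ltxx.
  have [C QC] := poly_expRN_bounded ('X^2 * Q).
  apply: (@is_derive0_quadratic _ C) => t; rewrite /cutoff_term.
  have C0 : 0 <= C by apply: le_trans (QC 0 (lexx _)).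
  case: ifPn => [t0|_]; last by rewrite normr0 mulr_ge0// sqr_ge0.
  have ti : 0 <= t^-1 by rewrite invr_ge0 ltW.
  have := QC _ ti; rewrite hornerM hornerXn -mulrA normrM.
  rewrite ger0_norm ?exprn_ge0// exprVn mulrC.
  by rewrite ler_pdivrMr ?exprn_gt0.
Unshelve. all: by end_near. Qed.

(** The flat function exp (-1/s), extended by 0 to s <= 0, and its derivative. *)
Definition cutoff : R -> R := cutoff_term 1.

Definition dcutoff : R -> R := cutoff_term 'X^2.

Lemma smooth1_cutoff : smooth1 setT cutoff.
Proof.
exists (fun n => cutoff_term (iter n (fun Q => 'X^2 * (Q - Q^`())) 1)).
by split => // n t _; exact: is_derive_cutoff_term.
Qed.

Lemma is_derive_cutoff (s : R) : is_derive s 1 cutoff (dcutoff s).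
Proof.
rewrite /dcutoff (_ : 'X^2 = 'X^2 * (1 - 1^`()) :> {poly R}).
  exact: is_derive_cutoff_term.
by rewrite derivC subr0 mulr1.
Qed.

Lemma cutoff0 (s : R) : s <= 0 -> cutoff s = 0.
Proof. by move=> s0; rewrite /cutoff /cutoff_term ltNge s0. Qed.

(** With E = [cutoff] and s = n t - 1, the derivative of t E(n t - 1) in t is
    E(s) + (s + 1) E'(s). Both E(s) and this derivative tend to 1 as s tends to
    infinity, so t E(n t - 1) approximates t together with its derivative. *)
Lemma cutoff_tail (s : R) : 1 <= s ->
  `|1 - cutoff s| <= 3 / s /\ `|1 - (cutoff s + (s + 1) * dcutoff s)| <= 3 / s.
Proof.
move=> s1; have s0 : 0 < s by apply: lt_le_trans s1.
rewrite /cutoff /dcutoff /cutoff_term s0 hornerC hornerXn.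
have -> : (s + 1) * (s^-1 ^+ 2 * expR (- s^-1)) =
    (s^-1 + s^-1 ^+ 2) * expR (- s^-1).
  by field; rewrite gt_eqF.
set y := s^-1.
have y0 : 0 < y by rewrite invr_gt0.
have y1 : y <= 1 by rewrite invf_le1.
have e1 := expR_ge1Dx (- y); have e2 : expR (- y) <= 1.
  by rewrite -expR0 ler_expR; lra.
set E := expR (- y) in e1 e2 *.
have E0 : 0 <= E by rewrite expR_ge0.
by split; rewrite ler_norml; apply/andP; split; nra.
Qed.

(** The bound uniform in s is what dominated convergence needs. *)
Lemma cutoff_bounded (s : R) :
  `|1 - cutoff s| <= 5 /\ `|1 - (cutoff s + (s + 1) * dcutoff s)| <= 5.
Proof.
rewrite /cutoff /dcutoff /cutoff_term hornerC hornerXn.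
case: ifPn => [s0|_]; last by rewrite mulr0 !addr0 subr0 normr1; split; lra.
have -> : (s + 1) * (s^-1 ^+ 2 * expR (- s^-1)) =
    (s^-1 + s^-1 ^+ 2) * expR (- s^-1).
  by field; rewrite gt_eqF.
set y := s^-1.
have y0 : 0 < y by rewrite invr_gt0.
have h1 := pow_expRN_le 1 (ltW y0); have h2 := pow_expRN_le 2 (ltW y0).
have e2 : expR (- y) <= 1.
  by rewrite -expR0 ler_expR; lra.
move: h1 h2; rewrite expr1 => h1 h2.
have E0 := expR_ge0 (- y); rewrite mulrDl.
have h3 : 0 <= y * expR (- y) by rewrite mulr_ge0// ltW.
have h4 : 0 <= y ^+ 2 * expR (- y) by rewrite mulr_ge0// sqr_ge0.
have f2 : 2`!%:R = 2 :> R by [].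
have f1 : 1`!%:R = 1 :> R by [].
rewrite f1 in h1; rewrite f2 in h2.
by split; rewrite ler_norml; apply/andP; split; lra.
Qed.

End cutoff_function.

(** * Borel measurability and boundedness in space *)

Section measurability.
Context {R : realType}.
Local Notation R3 := (R * R * R)%type.
Local Notation mR := (measurableTypeR R).
Local Notation mR3 := (mR * mR * mR)%type.

Definition box (a b : R) : set R3 :=
  [set` `]a, b[] `*` [set` `]a, b[] `*` [set` `]a, b[].

(** The sigma-algebra is the product one, so an open set is written as a
    countable union of boxes with rational centers and radii 1/(n+1). *)
Lemma open_measurable3 (A : set R3) : open A -> measurable (A : set mR3).
Proof.
move=> oA.
pose B (i : rat * rat * rat * nat) : set mR3 :=
  [set` `](ratr i.1.1.1 - i.2.+1%:R^-1 : R), (ratr i.1.1.1 + i.2.+1%:R^-1)[] `*`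
  [set` `](ratr i.1.1.2 - i.2.+1%:R^-1 : R), (ratr i.1.1.2 + i.2.+1%:R^-1)[] `*`
  [set` `](ratr i.1.2 - i.2.+1%:R^-1 : R), (ratr i.1.2 + i.2.+1%:R^-1)[].
pose F i := if `[< B i `<=` A >] then B i else set0.
have mB i : measurable (B i).
  by apply: measurableX; [apply: measurableX|]; exact: measurable_itv.
rewrite (_ : A = \bigcup_i F i).
  apply: countable_bigcupT_measurable => // i.
  by rewrite /F; case: ifP => _.
apply/seteqP; split=> [x Ax|x [i _]]; last first.
  by rewrite /F; case: asboolP => // BA; exact: BA.
have : nbhs x A by apply: open_nbhs_nbhs; split.
move=> /nbhs_ballP[e /= e0 eA].
have [n ne] : exists n : nat, n.+1%:R^-1 < e / 2 :> R.
  have [n _ /(_ _ (leqnn n)) nP] := near_infty_natSinv_lt (PosNum (divr_gt0 e0 (ltr0n R 2))).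
  by exists n.
pose d := n.+1%:R^-1 : R.
have d0 : 0 < d by rewrite invr_gt0 ltr0n.
have q (t : R) : exists q : rat, (t - d < ratr q < t + d).
  have /rat_in_itvoo[q] : t - d < t + d by rewrite ltrD2l gtrN.
  by rewrite in_itv/=; exists q.
have [q1 /andP[q1l q1r]] := q x.1.1.
have [q2 /andP[q2l q2r]] := q x.1.2.
have [q3 /andP[q3l q3r]] := q x.2.
exists (q1, q2, q3, n) => //; rewrite /F asboolT.
  by rewrite /B /= -/d !in_itv/=; split; [split => /=|]; lra.
rewrite /B /= -/d => y /= [[]]; rewrite !in_itv/= => y1 y2 y3; apply: eA.
rewrite -/d in ne.
by split; [split|]; rewrite /= /ball/= ltr_norml; lra.
Qed.

Lemma continuous_measurable3 (U : set R3) (f : R3 -> R) : open U ->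
  (forall x, U x -> {for x, continuous f}) ->
  measurable_fun (U : set mR3) (f : mR3 -> R).
Proof.
move=> oU cf; apply: (measurability _ (RGenOInfty.measurableE R)).
move=> _ [_ [a ->] <-]; apply: open_measurable3.
rewrite openE => x [Ux fx]; apply: filterI.
  by apply: open_nbhs_nbhs; split.
by apply: (cf _ Ux); apply: open_nbhs_nbhs; split.
Qed.

Lemma leb3_box (a b : R) : a < b -> leb3 (box a b) = ((b - a) ^+ 3)%:E.
Proof.
move=> ab; rewrite /box /leb3 /= product_measure1E/=; last 2 first.
  by apply: measurableX; exact: measurable_itv.
  exact: measurable_itv.
rewrite product_measure1E/=; [|exact: measurable_itv|exact: measurable_itv].
by rewrite lebesgue_measure_itv/= lte_fin ab -EFinD -!EFinM 2!exprSr expr1.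
Qed.

Lemma measurable_box (a b : R) : measurable (box a b : set mR3).
Proof.
by apply: measurableX; [apply: measurableX|]; exact: measurable_itv.
Qed.

Lemma bounded_leb3 (D : set R3) (A : R) : measurable (D : set mR3) ->
  D `<=` box (- A) A -> (leb3 D < +oo)%E.
Proof.
move=> mD DA.
have [A0|A0] := ltP 0 A; last first.
  rewrite (_ : D = set0) ?measure0 ?ltry//; apply/seteqP; split => // x /DA.
  by move=> [[]] /=; rewrite !in_itv/=; lra.
have mb := measurable_box (- A) A.
apply: (@le_lt_trans _ _ (leb3 (box (- A) A))).
  by apply: le_measure => //; rewrite inE.
by rewrite leb3_box ?ltry//; lra.
Qed.

Lemma bounded_integrable3 (D : set R3) (A M : R) (f : R3 -> R) :
  measurable (D : set mR3) -> D `<=` box (- A) A ->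
  measurable_fun (D : set mR3) (f : mR3 -> R) ->
  (forall x, D x -> `|f x| <= M) ->
  leb3.-integrable D (EFin \o f).
Proof.
move=> mD DA mf fM; apply: measurable_bounded_integrable => //.
  exact: bounded_leb3 DA.
exists M; split; first exact: num_real.
by move=> N MN x Dx; apply: le_trans (fM _ Dx) (ltW MN).
Qed.

Local Notation mu := (@lebesgue_measure R).

Lemma integral_derive1 (F G : R -> R) (A : R) : 0 < A ->
  (forall t : R, is_derive t 1 F (G t)) -> continuous G ->
  (forall t, A <= `|t| -> F t = 0) -> (forall t, A <= `|t| -> G t = 0) ->
  (\int[mu]_t (G t)%:E)%E = 0%E.
Proof.
move=> A0 dF cG F0 G0.
have AA : - A < A by lra.
have cF : continuous F by move=> t; exact: is_derive1_continuous (dF t).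
have GA (t : R) : ~~ (- A <= t <= A) -> G t = 0.
  rewrite negb_and -!ltNge => tA; apply: G0; rewrite ler_normr.
  by case/orP: tA => tA; apply/orP; [right|left]; lra.
transitivity (\int[mu]_(t in `[(- A)%R, A%R]) (G t)%:E)%E.
  rewrite [RHS]integral_mkcond; apply: eq_integral => t _.
  rewrite patchE; case: ifPn => //; rewrite notin_setE /= in_itv/= => /negP tA.
  by rewrite GA.
transitivity ((F A)%:E - (F (- A))%:E)%E; last first.
  have FA : F A = 0 by apply: F0; rewrite ger0_norm// ltW.
  have FNA : F (- A) = 0 by apply: F0; rewrite normrN ger0_norm// ltW.
  by rewrite FA FNA sube0.
apply: continuous_FTC2 => //.
- by apply: continuous_subspaceT.
- split.
  + by move=> t _; have [] := dF t.
  + by apply: cvg_at_right_filter; exact: cF.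
  + by apply: cvg_at_left_filter; exact: cF.
- by move=> t _; rewrite derive1E; have [_ ->] := dF t.
Qed.

(** [c] parametrizes a line with velocity [v]. *)
Lemma is_derive_slice (f : R3 -> R) (c : R -> R3) (v : R3) (t d : R) :
  (forall h, c (h + t) = h *: v + c t) ->
  is_derive (c t) v f d -> is_derive t 1 (f \o c) d.
Proof.
move=> cE [fd <-].
have E : (fun h : R => h^-1 *: ((f \o c) (h *: 1 + t) - (f \o c) t)) =
    (fun h => h^-1 *: (f (h *: v + c t) - f (c t))).
  by apply/funext => h /=; rewrite [h%:A]mulr1 cE.
apply: DeriveDef; first by move: fd; rewrite /derivable E.
by rewrite /derive E.
Qed.

End measurability.

(** * Integrals of partial derivatives *)

Section integration_by_parts.
Context {R : realType}.
Local Notation R3 := (R * R * R)%type.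
Local Notation mR := (measurableTypeR R).
Local Notation mR3 := (mR * mR * mR)%type.

Local Notation mu := (@lebesgue_measure R).
Section fubini_zero.
Local Open Scope ereal_scope.
Context d1 d2 (T1 : measurableType d1) (T2 : measurableType d2).
Variables (m1 : {sigma_finite_measure set T1 -> \bar R})
  (m2 : {sigma_finite_measure set T2 -> \bar R}).

Lemma integral12_eq0 (f : T1 * T2 -> R) :
  (m1 \x m2).-integrable setT (EFin \o f) ->
  (forall x, \int[m2]_y (f (x, y))%:E = 0) -> \int[m1 \x m2]_z (f z)%:E = 0.
Proof.
move=> fi f0; rewrite -(integral12_prod_meas1 fi).
by apply: integral0_eq => x _; exact: f0.
Qed.

(** The slices are integrable for almost every [y] only, so the vanishing of the
    inner integral may be asked under this assumption. *)
Lemma integral21_eq0 (f : T1 * T2 -> R) :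
  (m1 \x m2).-integrable setT (EFin \o f) ->
  (forall y, m1.-integrable setT (fun x => (f (x, y))%:E) ->
    \int[m1]_x (f (x, y))%:E = 0) -> \int[m1 \x m2]_z (f z)%:E = 0.
Proof.
move=> fi f0; rewrite -(integral21_prod_meas1 fi).
rewrite (@ae_eq_integral _ _ _ m2 setT (cst 0))//=.
- by rewrite integral0.
- exact: (measurable_fubini_G fi).
by move: (ae_integrable2 fi); apply: filterS => y iy _; exact: f0.
Qed.

End fubini_zero.

(** The product of the Lebesgue measures under a name of its own, to carry the
    sigma-finiteness that Fubini's theorem asks for. *)
Definition leb2 : set (mR * mR)%type -> \bar R :=
  (@lebesgue_measure R \x @lebesgue_measure R)%E.

HB.instance Definition _ := Measure.on leb2.

Let leb2_sigma_finite : sigma_finite setT leb2.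
Proof.
have /sigma_finiteP[F [TF ndF Foo]] := sigma_finiteT mu.
exists (fun n => F n `*` F n).
  rewrite -setXTT TF predeqE => -[x y]; split.
    move=> [/= [n _ Fnx] [k _ Gky]]; exists (maxn n k) => //; split.
    - by move: x Fnx; exact/subsetPset/ndF/leq_maxl.
    - by move: y Gky; exact/subsetPset/ndF/leq_maxr.
  by move=> [n _ []/= ? ?]; split; exists n.
move=> k; have [? ?] := Foo k.
split; first exact: measurableX.
by rewrite /leb2 product_measure1E// lte_mul_pinfty// ge0_fin_numE.
Qed.

HB.instance Definition _ := Measure_isSigmaFinite.Build _ _ _ leb2
  leb2_sigma_finite.

Lemma leb3_integral_eq0 (g : mR3 -> R) :
  leb3.-integrable setT (EFin \o g) ->
  [\/ forall x y, (\int[mu]_z (g (x, y, z))%:E)%E = 0%E,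
      forall x z, (\int[mu]_y (g (x, y, z))%:E)%E = 0%E |
      forall y z, (\int[mu]_x (g (x, y, z))%:E)%E = 0%E] ->
  (\int[leb3]_x (g x)%:E)%E = 0%E.
Proof.
move=> ig [] g0.
- by apply: (@integral12_eq0 _ _ _ _ leb2 mu g ig) => -[x y]; exact: g0.
- apply: (@integral21_eq0 _ _ _ _ leb2 mu g ig) => z iz.
  by apply: (@integral12_eq0 _ _ _ _ mu mu (fun w => g (w, z)) iz) => x; exact: g0.
- apply: (@integral21_eq0 _ _ _ _ leb2 mu g ig) => z iz.
  by apply: (@integral21_eq0 _ _ _ _ mu mu (fun w => g (w, z)) iz) => y _; exact: g0.
Qed.

Lemma continuous_pair (U V : normedModType R) (f : R -> U) (g : R -> V) :
  continuous f -> continuous g -> continuous (fun t => (f t, g t)).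
Proof. by move=> cf cg t; exact: (cvg_pair (cf t) (cg t)). Qed.

(** The integral along the [i]-th axis vanishes by the fundamental theorem of
    calculus; Fubini's theorem puts this axis innermost. *)
Lemma integral_pderiv (f g : R3 -> R) (i : 'I_3) (A M : R) : 0 < A ->
  (forall x, is_derive x (e3 i) f (g x)) -> (forall x, {for x, continuous g}) ->
  (forall x, ~ box (- A) A x -> f x = 0) ->
  (forall x, ~ box (- A) A x -> g x = 0) ->
  (forall x, `|g x| <= M) ->
  \int[leb3]_x g x = 0.
Proof.
move=> A0 dfg cg f0 g0 gM.
have mg : measurable_fun setT (g : mR3 -> R).
  by apply: continuous_measurable3; first exact: openT.
have ig : leb3.-integrable setT (EFin \o g).
  have mb := measurable_box (- A) A.
  rewrite (_ : EFin \o g = (EFin \o g) \_ (box (- A) A)).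
    apply: (iffLR (integrable_mkcond _ mb)).
    by apply: (@bounded_integrable3 _ _ A M) => //; exact: measurable_funTS.
  apply/funext => x; rewrite patchE; case: ifPn => //.
  by rewrite notin_setE => /g0 /= ->.
have big (c : R -> R3) t : (forall t, (c t).1.1 = t \/ (c t).1.2 = t \/ (c t).2 = t) ->
    A <= `|t| -> ~ box (- A) A (c t).
  move=> /(_ t) ct At [[]] /=; rewrite !in_itv/= => c1 c2 c3.
  have : - A < t < A by case: ct => [|[]] E; move: c1 c2 c3; rewrite E.
  by move: At; rewrite -ltr_norml; lra.
have slice (c : R -> R3) :
    (forall t, (c t).1.1 = t \/ (c t).1.2 = t \/ (c t).2 = t) ->
    continuous c -> (forall t h, c (h + t) = h *: e3 i + c t) ->
    (\int[mu]_t (g (c t))%:E)%E = 0%E.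
  move=> ct cc cE; apply: (@integral_derive1 _ (f \o c) (g \o c) A) => //.
  - by move=> t; apply: is_derive_slice (dfg (c t)).
  - by move=> t; apply: continuous_comp; [exact: cc|exact: cg].
  - by move=> t At; apply: f0; exact: big.
  - by move=> t At; apply: g0; exact: big.
rewrite /Rintegral.
suff -> : (\int[leb3]_x (g x)%:E)%E = 0%E by [].
apply: (leb3_integral_eq0 ig).
have [i2|i2] := eqVneq i 2.
  apply: Or31 => x y; apply: (slice (fun t => (x, y, t))).
  - by move=> t; right; right.
  - by apply: continuous_pair => t; [exact: cvg_cst|exact: cvg_id].
  - by move=> t h; rewrite i2 /e3/=; congr (_, _, _); rewrite /= ?scaler0 ?add0r// [_%:A]mulr1.
have [i1|i1] := eqVneq i 1.
  apply: Or32 => x z; apply: (slice (fun t => (x, t, z))).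
  - by move=> t; right; left.
  - apply: continuous_pair => [|t]; last exact: cvg_cst.
    by apply: continuous_pair => t; [exact: cvg_cst|exact: cvg_id].
  - by move=> t h; rewrite i1 /e3/=; congr (_, _, _); rewrite /= ?scaler0 ?add0r// [_%:A]mulr1.
have i0 : i = 0.
  apply: val_inj; move: i1 i2; rewrite -!val_eqE.
  by case: i {dfg slice} => -[|[|[|]]].
apply: Or33 => y z; apply: (slice (fun t => (t, y, z))).
- by move=> t; left.
- apply: continuous_pair => [|t]; last exact: cvg_cst.
  by apply: continuous_pair => t; [exact: cvg_id|exact: cvg_cst].
- by move=> t h; rewrite i0 /e3/=; congr (_, _, _); rewrite /= ?scaler0 ?add0r// [_%:A]mulr1.
Qed.

End integration_by_parts.

(** * Test functions *)

Section test_functions.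
Context {R : realType}.
Local Notation R3 := (R * R * R)%type.
Local Notation mR := (measurableTypeR R).
Local Notation mR3 := (mR * mR * mR)%type.
Variable Om : set R3.
Hypothesis oOm : open Om.
Variable A : R.
Hypothesis A0 : 0 < A.
Hypothesis OmA : Om `<=` box (- A) A.
Implicit Types (f g u v w phi : R3 -> R).

Let mOm : measurable (Om : set mR3). Proof. exact: open_measurable3. Qed.

Let compact_openC (K : set R3) : compact K -> open (~` K).
Proof.
move=> cK; apply: closed_openC; apply: compact_closed cK.
exact: (@norm_hausdorff R R3).
Qed.

(** Smoothness inside the domain and compact support give smoothness on the
    whole space: the function vanishes on the open complement of its support. *)
Lemma Cc_local phi : smooth_on Om phi ->
  (exists K : set R3, [/\ compact K, K `<=` Om & forall x, ~ K x -> phi x = 0]) ->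
  Cc_smooth Om phi.
Proof.
move=> sphi [K [cK KOm phi0]]; split; last by exists K.
apply/smooth_onE; have oK : open (~` K).
  exact: compact_openC.
have sK : smooth_on (~` K) phi.
  apply: smooth_on_eq oK _ (smooth_on_cst (~` K) 0).
  by move=> x Kx; rewrite phi0.
apply: smooth_on_sub (smooth_onU sphi sK) => x _.
by have [/KOm|] := pselect (K x); [left|right].
Qed.

Lemma Cc_smooth_on U phi : Cc_smooth Om phi -> smooth_on U phi.
Proof. by move=> [/smooth_onE s _]; apply: smooth_on_sub s. Qed.

Lemma Cc_out phi x : Cc_smooth Om phi -> ~ Om x -> phi x = 0.
Proof. by move=> [_ [K [_ KOm phi0]]] Ox; apply: phi0 => /KOm. Qed.

Lemma Cc_D phi i : Cc_smooth Om phi -> Cc_smooth Om ('D_(e3 i) phi).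
Proof.
move=> cphi; have sphi := Cc_smooth_on Om cphi.
case: cphi => [_ [K [cK KOm phi0]]].
apply: Cc_local; first exact: smooth_on_D.
exists K; split => // x Kx; have oK : open (~` K).
  exact: compact_openC.
rewrite -(derive_cst (0 : R) x (e3 i)); apply: near_eq_derive.
by apply: open_near oK Kx _ => y Ky; rewrite phi0.
Qed.

Lemma Cc_mul u phi : smooth_on Om u -> Cc_smooth Om phi ->
  Cc_smooth Om (fun x => u x * phi x).
Proof.
move=> su cphi; apply: Cc_local.
  exact: (smooth_on_mul oOm su (Cc_smooth_on Om cphi)).
have [_ [K [cK KOm phi0]]] := cphi.
by exists K; split => // x /phi0 ->; rewrite mulr0.
Qed.

Lemma Cc_add u v : Cc_smooth Om u -> Cc_smooth Om v ->
  Cc_smooth Om (fun x => u x + v x).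
Proof.
move=> cu cv; apply: Cc_local.
  exact: (smooth_on_add oOm (Cc_smooth_on Om cu) (Cc_smooth_on Om cv)).
have [_ [K [cK KOm u0]]] := cu.
have [_ [L [cL LOm v0]]] := cv.
exists (K `|` L); split; first exact: compactU.
  by move=> x [/KOm|/LOm].
by move=> x /not_orP[/u0 -> /v0 ->]; rewrite addr0.
Qed.

Lemma Cc_scale (a : R) u : Cc_smooth Om u -> Cc_smooth Om (fun x => a * u x).
Proof. by move=> cu; exact: (Cc_mul (smooth_on_cst Om a) cu). Qed.

Lemma Cc_sub u v : Cc_smooth Om u -> Cc_smooth Om v ->
  Cc_smooth Om (u \- v).
Proof.
move=> cu cv; rewrite (_ : u \- v = fun x => u x + (-1) * v x).
  exact: (Cc_add cu (Cc_scale (-1) cv)).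
by apply/funext => x /=; rewrite mulN1r.
Qed.

Lemma Cc_bounded phi : Cc_smooth Om phi -> exists M, forall x, `|phi x| <= M.
Proof.
move=> [/smooth_onE sphi [K [cK KOm phi0]]].
have cphi : continuous phi by move=> x; exact: smooth_on_continuous sphi _ _.
have /compact_bounded[M [_ MP]] : compact (phi @` K).
  by apply: continuous_compact => //; exact: continuous_subspaceT.
exists (Num.max 0 (M + 1)) => x.
have [Kx|Kx] := pselect (K x); last by rewrite phi0// normr0 le_max lexx.
rewrite le_max; apply/orP; right; apply: (MP (M + 1)); first by rewrite ltrDl.
by exists x.
Qed.

(** * Square integrable functions on the domain *)

(** On a bounded domain these functions are integrable together with all their
    products, which discharges most integrability conditions below. *)
Definition bounded_measurable f := measurable_fun (Om : set mR3) (f : mR3 -> R) /\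
  exists M, forall x, Om x -> `|f x| <= M.

Lemma bmeas_integrable f : bounded_measurable f -> leb3.-integrable Om (EFin \o f).
Proof. by move=> [mf [M fM]]; exact: bounded_integrable3 OmA mf fM. Qed.

Lemma smooth_on_measurable f : smooth_on Om f ->
  measurable_fun (Om : set mR3) (f : mR3 -> R).
Proof.
by move=> sf; apply: continuous_measurable3 => // x Ox; exact: smooth_on_continuous sf _ _.
Qed.

Lemma bmeas_smooth f M : smooth_on Om f -> (forall x, Om x -> `|f x| <= M) -> bounded_measurable f.
Proof. by move=> sf fM; split; [exact: smooth_on_measurable|exists M]. Qed.

Lemma bmeas_Cc f : Cc_smooth Om f -> bounded_measurable f.
Proof.
move=> cf; have [M fM] := Cc_bounded cf; apply: (@bmeas_smooth _ M) => //.
exact: Cc_smooth_on.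
Qed.

Lemma bmeas_mul f g : bounded_measurable f -> bounded_measurable g -> bounded_measurable (fun x => f x * g x).
Proof.
move=> [mf [M fM]] [mg [N gN]]; split; first exact: measurable_funM.
by exists (M * N) => x Ox; rewrite normrM ler_pM// ?fM ?gN.
Qed.

Lemma bmeas_add f g : bounded_measurable f -> bounded_measurable g -> bounded_measurable (fun x => f x + g x).
Proof.
move=> [mf [M fM]] [mg [N gN]]; split; first exact: measurable_funD.
by exists (M + N) => x Ox; apply: le_trans (ler_normD _ _) _; rewrite lerD ?fM ?gN.
Qed.

Lemma bmeas_cst (a : R) : bounded_measurable (fun _ => a).
Proof. by split => //; exists `|a|. Qed.

Lemma bmeas_sub f g : bounded_measurable f -> bounded_measurable g -> bounded_measurable (f \- g).
Proof.
move=> bf bg; rewrite (_ : f \- g = fun x => f x + (-1) * g x).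
  by apply: bmeas_add => //; apply: bmeas_mul => //; exact: bmeas_cst.
by apply/funext => x /=; rewrite mulN1r.
Qed.

Lemma bmeas_L2 f : bounded_measurable f -> L2 Om f.
Proof.
move=> bf; split; first by case: bf.
have := bmeas_integrable (bmeas_mul bf bf).
by apply: eq_integrable => // x _ /=; rewrite expr2.
Qed.

Lemma L2_mul u v : L2 Om u -> L2 Om v ->
  leb3.-integrable Om (EFin \o (fun x => u x * v x)).
Proof.
move=> [mu iu] [mv iv].
apply: le_integrable (integrableD _ iu iv) => //.
  by apply/measurable_EFinP; exact: measurable_funM.
move=> x Ox /=; rewrite lee_fin [leRHS]ger0_norm ?addr_ge0 ?sqr_ge0//.
have := sqr_ge0 (u x - v x); have := sqr_ge0 (u x + v x).
by rewrite ler_norml; nra.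
Qed.

Lemma L2_scale (a : R) u : L2 Om u -> L2 Om (fun x => a * u x).
Proof.
move=> [mu iu]; split; first exact: measurable_funM.
have := integrableZl mOm (a ^+ 2) iu.
by apply: eq_integrable => // x _ /=; rewrite -EFinM exprMn.
Qed.

Lemma L2_add u v : L2 Om u -> L2 Om v -> L2 Om (fun x => u x + v x).
Proof.
move=> [mu iu] [mv iv]; split; first exact: measurable_funD.
have i2 := integrableZl mOm 2 (integrableD mOm iu iv).
apply: le_integrable i2 => //.
  by apply/measurable_EFinP; apply: measurable_funX; exact: measurable_funD.
move=> x Ox /=; rewrite lee_fin !ger0_norm ?sqr_ge0 ?mulr_ge0 ?addr_ge0 ?sqr_ge0//.
by have := sqr_ge0 (u x - v x); nra.
Qed.

Lemma L2_sub u v : L2 Om u -> L2 Om v -> L2 Om (u \- v).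
Proof.
move=> lu lv; rewrite (_ : u \- v = fun x => u x + (-1) * v x).
  by apply: L2_add => //; exact: L2_scale.
by apply/funext => x /=; rewrite mulN1r.
Qed.

Lemma eq_ip u u' v v' : (forall x, Om x -> u x = u' x) ->
  (forall x, Om x -> v x = v' x) -> ip Om u v = ip Om u' v'.
Proof.
by move=> uu vv; apply: eq_Rintegral => x; rewrite inE => Ox; rewrite uu// vv.
Qed.

Lemma ipC u v : ip Om u v = ip Om v u.
Proof. by apply: eq_Rintegral => x _; rewrite mulrC. Qed.

Lemma ipDl u v w : L2 Om u -> L2 Om v -> L2 Om w ->
  ip Om (fun x => u x + v x) w = ip Om u w + ip Om v w.
Proof.
move=> lu lv lw; rewrite /ip -RintegralD//; [|exact: L2_mul|exact: L2_mul].
by apply: eq_Rintegral => x _; rewrite mulrDl.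
Qed.

Lemma ipZl (a : R) u w : L2 Om u -> L2 Om w ->
  ip Om (fun x => a * u x) w = a * ip Om u w.
Proof.
move=> lu lw; rewrite /ip -RintegralZl//; last exact: L2_mul.
by apply: eq_Rintegral => x _; rewrite mulrA.
Qed.

Lemma ipBl u v w : L2 Om u -> L2 Om v -> L2 Om w ->
  ip Om (u \- v) w = ip Om u w - ip Om v w.
Proof.
move=> lu lv lw; rewrite -mulN1r -ipZl// -ipDl//; last exact: L2_scale.
by apply: eq_ip => // x _; rewrite mulN1r.
Qed.

Lemma ip_ge0 u : 0 <= ip Om u u.
Proof. by apply: Rintegral_ge0 => x _; rewrite -expr2 sqr_ge0. Qed.

(** From the nonnegativity of the square norms of u - d v and u + d v. *)
Lemma ip_young (d : R) u v : 0 < d -> L2 Om u -> L2 Om v ->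
  `|ip Om u v| <= (ip Om u u / d + d * ip Om v v) / 2.
Proof.
move=> d0 lu lv.
have d1 : d / d = 1 by rewrite divff// gt_eqF.
have h (e : R) : e ^+ 2 = 1 -> e * ip Om u v <= (ip Om u u / d + d * ip Om v v) / 2.
  move=> e1; have := ip_ge0 (fun x => u x + (- e * d) * v x).
  have lv' := L2_scale (- e * d) lv.
  have lw := L2_add lu lv'.
  rewrite (ipDl lu lv' lw) (ipZl _ lv lw) (ipC u) (ipC v).
  rewrite (ipDl lu lv' lu) (ipDl lu lv' lv) (ipZl _ lv lu) (ipZl _ lv lv).
  rewrite [ip Om v u]ipC => h.
  suff : 0 <= (ip Om u u / d + d * ip Om v v) / 2 - e * ip Om u v by rewrite subr_ge0.
  have -> : (ip Om u u / d + d * ip Om v v) / 2 - e * ip Om u v =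
    (ip Om u u + - e * d * ip Om u v +
     - e * d * (ip Om u v + - e * d * ip Om v v)) / (2 * d).
    have -> : - e * d * (ip Om u v + - e * d * ip Om v v) =
       - e * d * ip Om u v + (e ^+ 2) * d ^+ 2 * ip Om v v by ring.
    by rewrite e1; field; rewrite gt_eqF.
  by apply: divr_ge0; [exact: h|rewrite mulr_ge0// ltW].
rewrite ler_norml; apply/andP; split; last by rewrite -[leLHS]mul1r h// expr1n.
by rewrite lerNl -mulN1r h// sqrrN expr1n.
Qed.

(** Convergence in norm implies weak convergence, by [ip_young] with a small
    weight on [v]. *)
Lemma ip_cvg (un : nat -> R3 -> R) u v : L2 Om u -> (forall n, L2 Om (un n)) ->
  L2 Om v -> ip Om (un n \- u) (un n \- u) @[n --> \oo] --> 0 ->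
  ip Om (un n) v @[n --> \oo] --> ip Om u v.
Proof.
move=> lu lun lv /cvgr0Pnorm_lt cu; apply/cvgrPdist_lt => e e0.
(* the weight makes d <v, v> at most e; the other term is then eventually < e *)
pose d := e / (ip Om v v + 1).
have N0 := ip_ge0 v.
have d0 : 0 < d by apply: divr_gt0 => //; lra.
have := cu (d * e) (mulr_gt0 d0 e0); apply: filterS => n un_small.
rewrite distrC -ipBl//.
apply: le_lt_trans (ip_young d0 (L2_sub (lun n) lu) lv) _.
move: un_small; rewrite ger0_norm ?ip_ge0// => un_small.
have h1 : ip Om (un n \- u) (un n \- u) / d < e by rewrite ltr_pdivrMr// mulrC.
have h2 : d * ip Om v v <= e.
  by rewrite /d mulrAC ler_pdivrMr; [nra|lra].
lra.
Qed.

(** * Integration by parts and the energy form *)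

Lemma Cc_ibp0 phi i : Cc_smooth Om phi ->
  \int[leb3]_(x in Om) 'D_(e3 i) phi x = 0.
Proof.
move=> cphi; have cD := Cc_D i cphi; have [M DM] := Cc_bounded cD.
have sphi := Cc_smooth_on setT cphi.
rewrite Rintegral_mkcond (_ : _ \_ Om = 'D_(e3 i) phi); last first.
  apply/funext => x; rewrite patchE; case: ifPn => //.
  by rewrite notin_setE => Ox; rewrite (Cc_out cD).
apply: (@integral_pderiv _ phi _ i A M) => //.
- by move=> x; apply/derivableP; exact: smooth_on_derivable sphi _ _.
- by move=> x; exact: smooth_on_continuous (smooth_on_D i sphi) _ _.
- by move=> x bx; apply: Cc_out cphi _ => /OmA.
- by move=> x bx; apply: Cc_out cD _ => /OmA.
Qed.

(** The integral of the derivative of [u * phi], which is again a test function,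
    is 0. *)
Lemma Cc_ibp u phi i : smooth_on Om u -> Cc_smooth Om phi ->
  ip Om u ('D_(e3 i) phi) = - ip Om ('D_(e3 i) u) phi.
Proof.
move=> su cphi; apply/eqP; rewrite -subr_eq0 opprK; apply/eqP.
have := Cc_ibp0 i (Cc_mul su cphi); move=> <-.
rewrite /ip -RintegralD//; last 2 first.
- exact: (bmeas_integrable (bmeas_Cc (Cc_mul su (Cc_D i cphi)))).
- exact: (bmeas_integrable (bmeas_Cc (Cc_mul (smooth_on_D i su) cphi))).
apply: eq_Rintegral => x; rewrite inE => Ox.
rewrite deriveM_fun ?[phi x * _]mulrC//; first exact: smooth_on_derivable su _ _.
exact: smooth_on_derivable (Cc_smooth_on Om cphi) _ _.
Qed.

Lemma Cc_deriveM f g i x : smooth_on Om f -> smooth_on Om g -> Om x ->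
  'D_(e3 i) (fun y => f y * g y) x =
  f x * 'D_(e3 i) g x + g x * 'D_(e3 i) f x.
Proof.
by move=> sf sg Ox; rewrite deriveM_fun//; exact: smooth_on_derivable Ox.
Qed.

Lemma Cc_sum (r : seq 'I_3) (F : 'I_3 -> R3 -> R) :
  (forall i, Cc_smooth Om (F i)) -> Cc_smooth Om (fun x => \sum_(i <- r) F i x).
Proof.
move=> cF; elim: r => [|i r IH].
  under eq_fun do rewrite big_nil.
  apply: Cc_local; first exact: smooth_on_cst.
  by exists set0; split => //; exact: compact0.
under eq_fun do rewrite big_cons.
exact: Cc_add.
Qed.

Lemma Cc_integrable f : Cc_smooth Om f -> leb3.-integrable Om (EFin \o f).
Proof. by move=> cf; apply: bmeas_integrable; exact: bmeas_Cc. Qed.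

Lemma Cc_int_sum (r : seq 'I_3) (F : 'I_3 -> R3 -> R) :
  (forall i, Cc_smooth Om (F i)) ->
  \int[leb3]_(x in Om) (\sum_(i <- r) F i x) =
  \sum_(i <- r) \int[leb3]_(x in Om) F i x.
Proof.
move=> cF; elim: r => [|i r IH].
  rewrite big_nil -[RHS](mul0r (fine (leb3 Om))) -Rintegral_cst//.
  by apply: eq_Rintegral => x _; rewrite big_nil.
rewrite big_cons -IH -RintegralD//.
- by apply: eq_Rintegral => x _; rewrite big_cons.
- exact: Cc_integrable.
- by apply: Cc_integrable; exact: Cc_sum.
Qed.

Lemma mul_laplacian (a : R) f x :
  a * - laplacian f x = \sum_(i < 3) - a * 'D_(e3 i) ('D_(e3 i) f) x.
Proof. by rewrite mulrN -mulNr mulr_sumr. Qed.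

(** The energy form. It is symmetric in [u] and [phi] when both are test
    functions, and still makes sense for [u] smooth in the domain only. *)
Lemma Cc_ipT u phi : smooth_on Om u -> Cc_smooth Om phi ->
  ip Om u (fun x => - laplacian phi x) =
  \sum_(i < 3) ip Om ('D_(e3 i) u) ('D_(e3 i) phi).
Proof.
move=> su cphi.
have sNu := smooth_on_opp oOm su.
transitivity (\int[leb3]_(x in Om)
    \sum_(i < 3) (- u x * 'D_(e3 i) ('D_(e3 i) phi) x)).
  by apply: eq_Rintegral => x _; rewrite mul_laplacian.
rewrite Cc_int_sum; last first.
  by move=> i; exact: (Cc_mul sNu (Cc_D i (Cc_D i cphi))).
apply: eq_bigr => i _.
have cDD : Cc_smooth Om ('D_(e3 i) ('D_(e3 i) phi)) by apply: Cc_D; exact: Cc_D.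
have iuD := Cc_integrable (Cc_mul su cDD).
have E := Cc_ibp i su (Cc_D i cphi).
have -> : ip Om ('D_(e3 i) u) ('D_(e3 i) phi) =
    -1 * ip Om u ('D_(e3 i) ('D_(e3 i) phi)) by rewrite E mulN1r opprK.
rewrite /ip -(RintegralZl (-1) mOm iuD).
by apply: eq_Rintegral => x _; rewrite mulN1r mulNr.
Qed.

(** * The lower bound for the eigenvalues *)

Variables (h : R3 -> R) (lam : R).
Hypothesis lam0 : 0 <= lam.
Hypothesis sh : smooth_on Om h.
Hypothesis h0 : forall x, Om x -> 0 < h x.
Hypothesis lap_h : forall x, Om x -> laplacian h x = - lam * h x.

Let T v : R3 -> R := fun x => - laplacian v x.

Lemma smooth_on_inv : smooth_on Om (fun x => (h x)^-1).
Proof.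
apply: (@smooth_on_eq _ _ ((fun t : R => t `^ (-1)) \o h) _ oOm).
  by move=> x Ox /=; rewrite powR_inv1// ltW// h0.
exact: (smooth_on_comp oOm (smooth1_powR (-1)) h0 sh).
Qed.

(** With q = v / h, the field X_i = q v d_i h - v d_i v satisfies
    d_i X_i = - (d_i v - q d_i h)^2 + v (q d_i^2 h - d_i^2 v), and the terms
    v q d_i^2 h sum up to v q Delta h = - lam v^2. *)
Lemma picone v : Cc_smooth Om v -> lam * ip Om v v <= ip Om v (T v).
Proof.
move=> cv; have sv := Cc_smooth_on Om cv.
have sD f i : smooth_on Om f -> smooth_on Om ('D_(e3 i) f) by exact: smooth_on_D.
pose q x := v x / h x.
have sq : smooth_on Om q by exact: (smooth_on_mul oOm sv smooth_on_inv).
pose X i x := q x * 'D_(e3 i) h x * v x + - 'D_(e3 i) v x * v x.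
have cX i : Cc_smooth Om (X i).
  apply: Cc_add; apply: (Cc_mul _ cv).
    exact: (smooth_on_mul oOm sq (sD _ i sh)).
  exact: (smooth_on_opp oOm (sD _ i sv)).
have Dq i x : Om x -> h x * 'D_(e3 i) q x = 'D_(e3 i) v x - q x * 'D_(e3 i) h x.
  move=> Ox; have hx : h x != 0 by rewrite gt_eqF// h0.
  have -> : 'D_(e3 i) v x = 'D_(e3 i) (fun y => h y * q y) x.
    apply: near_eq_derive; apply: (open_near oOm Ox) => y Oy.
    by rewrite /q mulrC divfK// gt_eqF// h0.
  by rewrite (Cc_deriveM i sh sq Ox) addrK.
have alg (V Q H DV DH DQ DDH DDV : R) : V = H * Q -> H * DQ = DV - Q * DH ->
    (Q * DH + -1 * DV) * DV + V * (Q * DDH + DH * DQ + (-1 * DDV + DV * 0)) =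
    - (DV - Q * DH) ^+ 2 + V * (Q * DDH - DDV).
  move=> -> E; transitivity ((Q * DH - DV) * DV + Q * DH * (H * DQ) +
    H * Q * (Q * DDH - DDV)); first by ring.
  by rewrite E; ring.
have DX i x : Om x -> 'D_(e3 i) (X i) x =
    - ('D_(e3 i) v x - q x * 'D_(e3 i) h x) ^+ 2
    + v x * (q x * 'D_(e3 i) ('D_(e3 i) h) x - 'D_(e3 i) ('D_(e3 i) v) x).
  move=> Ox; have hx : h x != 0 by rewrite gt_eqF// h0.
  have -> : X i = fun x => (q x * 'D_(e3 i) h x + -1 * 'D_(e3 i) v x) * v x.
    by apply/funext => y; rewrite /X; ring.
  have s1 : smooth_on Om (fun x => q x * 'D_(e3 i) h x).
    exact: (smooth_on_mul oOm sq (sD _ i sh)).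
  have s2 : smooth_on Om (fun x => -1 * 'D_(e3 i) v x).
    exact: (smooth_on_scale (-1) oOm (sD _ i sv)).
  rewrite (Cc_deriveM i (smooth_on_add oOm s1 s2) sv Ox).
  rewrite (deriveD_fun (smooth_on_derivable s1 Ox) (smooth_on_derivable s2 Ox)).
  rewrite (Cc_deriveM i sq (sD _ i sh) Ox).
  rewrite (Cc_deriveM i (smooth_on_cst Om (-1)) (sD _ i sv) Ox).
  rewrite derive_cst.
  have vE : v x = h x * q x by rewrite /q mulrC divfK.
  exact: alg vE (Dq i x Ox).
have cL : Cc_smooth Om (fun x => v x * v x) by exact: (Cc_mul sv cv).
have cT : Cc_smooth Om (fun x => v x * T v x).
  rewrite (_ : (fun x => _) =
    fun x => \sum_(i < 3) (- v x * 'D_(e3 i) ('D_(e3 i) v) x)).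
    by apply: Cc_sum => i; exact: (Cc_mul (smooth_on_opp oOm sv) (Cc_D i (Cc_D i cv))).
  by apply/funext => x; rewrite /T mul_laplacian.
pose DXs x := \sum_(i < 3) 'D_(e3 i) (X i) x.
have cDX i : Cc_smooth Om ('D_(e3 i) (X i)) by exact: Cc_D.
have cDXs : Cc_smooth Om DXs by exact: Cc_sum.
have DX0 : \int[leb3]_(x in Om) DXs x = 0.
  by rewrite Cc_int_sum// big1// => i _; exact: Cc_ibp0.
have clL : Cc_smooth Om (fun x => lam * (v x * v x)).
  exact: Cc_scale.
rewrite -subr_ge0 /ip -RintegralZl//; last exact: Cc_integrable.
rewrite -RintegralB//; [|exact: Cc_integrable|exact: Cc_integrable].
rewrite -DX0; apply: le_Rintegral => //.
- exact: Cc_integrable.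
- by apply: Cc_integrable; exact: Cc_sub.
move=> x Ox; have hx : h x != 0 by rewrite gt_eqF// h0.
have -> : lam * (v x * v x) = - v x * q x * laplacian h x.
  rewrite lap_h//; have -> : v x * v x = v x * q x * h x by rewrite /q -mulrA divfK.
  by ring.
rewrite /T mul_laplacian /laplacian mulr_sumr -sumrB /DXs.
apply: ler_sum => i _; rewrite DX// -subr_ge0.
have alg2 (V Q a b s : R) : - V * b - - V * Q * a - (- s + V * (Q * a - b)) = s.
  by ring.
by rewrite alg2 sqr_ge0.
Qed.

Lemma ip_sub_sub u v u' v' : L2 Om u -> L2 Om v -> L2 Om u' -> L2 Om v' ->
  ip Om (u \- v) (u' \- v') =
  ip Om u u' - ip Om u v' - ip Om v u' + ip Om v v'.
Proof.
move=> lu lv lu' lv'; have ls := L2_sub lu' lv'.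
rewrite (ipBl lu lv ls) (ipC u) (ipC v) (ipBl lu' lv' lu) (ipBl lu' lv' lv).
by rewrite (ipC u') (ipC v') (ipC u') (ipC v'); ring.
Qed.

Lemma laplacianB v w x : Cc_smooth Om v -> Cc_smooth Om w ->
  laplacian (v \- w) x = laplacian v x - laplacian w x.
Proof.
move=> cv cw; rewrite /laplacian -sumrB; apply: eq_bigr => i _.
have D1 f g y : smooth_on setT f -> smooth_on setT g ->
    'D_(e3 i) (f \- g) y = 'D_(e3 i) f y - 'D_(e3 i) g y.
  move=> sf sg.
  by rewrite -(deriveB (smooth_on_derivable sf I) (smooth_on_derivable sg I)).
have sv := Cc_smooth_on setT cv; have sw := Cc_smooth_on setT cw.
rewrite (_ : 'D_(e3 i) (v \- w) = 'D_(e3 i) v \- 'D_(e3 i) w).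
  by rewrite (D1 _ _ _ (smooth_on_D i sv) (smooth_on_D i sw)).
by apply/funext => y; rewrite (D1 _ _ _ sv sw).
Qed.

Lemma L2_Cc v : Cc_smooth Om v -> L2 Om v.
Proof. by move=> cv; apply: bmeas_L2 => //; exact: bmeas_Cc. Qed.

Lemma Cc_T v : Cc_smooth Om v -> Cc_smooth Om (T v).
Proof.
move=> cv; rewrite (_ : T v = fun x => \sum_(i < 3) (- 1) * 'D_(e3 i) ('D_(e3 i) v) x).
  by apply: Cc_sum => i; exact: (Cc_scale _ (Cc_D i (Cc_D i cv))).
by apply/funext => x; rewrite -mul_laplacian mul1r.
Qed.

Lemma ip_L2_gt0 u : L2 Om u -> ~ {ae leb3, forall x, Om x -> u x = 0} ->
  0 < ip Om u u.
Proof.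
move=> [mu iu] une; rewrite lt_neqAle ip_ge0 andbT eq_sym; apply/eqP => ip0.
apply: une.
have : (\int[leb3]_(x in Om) `|(u x ^+ 2)%:E| = 0)%E.
  have -> : (\int[leb3]_(x in Om) `|(u x ^+ 2)%:E| = \int[leb3]_(x in Om) (u x ^+ 2)%:E)%E.
    by apply: eq_integral => x _; rewrite gee0_abs// lee_fin sqr_ge0.
  rewrite -[LHS]fineK; last exact: integrable_fin_num.
  congr EFin; rewrite -[RHS]ip0; apply: eq_Rintegral => x _.
  by rewrite expr2.
move/ae_eq_integral_abs => /(_ mOm)[|N [mN N0 NP]].
  by apply/measurable_EFinP; exact: measurable_funX.
exists N; split => //; apply: subset_trans NP => x /= ux0 uux; apply: ux0 => Ox.
have /eqP := uux Ox; rewrite eqe sqrf_eq0 => /eqP //.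
Qed.

(** Let B be the form of - Delta - lam on test functions; it is symmetric and
    nonnegative by [picone]. If phi_n converges to the eigenfunction u and is
    Cauchy for the energy, polarization gives
    2 B(phi_m, phi_n) >= - B(phi_m - phi_n, phi_m - phi_n), which is bounded
    below by - e for large m and n. As m tends to infinity, B(phi_m, phi_n)
    tends to (mu - lam) <u, phi_n>, and then n tends to infinity. *)
Lemma eigenvalue_ge mu : eigenvalue_laplacian Om mu -> lam <= mu.
Proof.
move=> [u [une [_ _ [lu _ wu [phi [cphi phiu phiC]]]]]].
have u0 := ip_L2_gt0 lu une.
have lphi n : L2 Om (phi n) by exact: L2_Cc.
pose B v w := ip Om v (T w) - lam * ip Om v w.
have BC v w : Cc_smooth Om v -> Cc_smooth Om w -> B v w = B w v.
  move=> cv cw; rewrite /B (ipC v w); have -> : ip Om v (T w) = ip Om w (T v).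
    rewrite (Cc_ipT (Cc_smooth_on Om cv) cw) (Cc_ipT (Cc_smooth_on Om cw) cv).
    by apply: eq_bigr => i _; exact: ipC.
  by [].
have BB v w : Cc_smooth Om v -> Cc_smooth Om w ->
    B (v \- w) (v \- w) = B v v + B w w - 2 * B v w.
  move=> cv cw; have lv := L2_Cc cv; have lw := L2_Cc cw.
  have lTv := L2_Cc (Cc_T cv); have lTw := L2_Cc (Cc_T cw).
  have cvw : Cc_smooth Om (v \- w) by exact: Cc_sub.
  have lvw := L2_Cc cvw.
  have TB : T (v \- w) = T v \- T w.
    by apply/funext => x; rewrite /T /= laplacianB// opprB opprK addrC.
  have alg (l a b c d a' b' c' d' : R) : c' = b' -> c - l * c' = b - l * b' ->
      (a - b - c + d) - l * (a' - b' - c' + d') =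
      (a - l * a') + (d - l * d') - 2 * (b - l * b') by move=> -> E; lra.
  rewrite /B TB (ip_sub_sub lv lw lTv lTw) (ip_sub_sub lv lw lv lw).
  exact: alg (ipC w v) (BC _ _ cw cv).
have B0 v : Cc_smooth Om v -> 0 <= B v v by move=> cv; rewrite subr_ge0 picone.
have key e : 0 < e -> - e <= (mu - lam) * ip Om u u.
  move=> e0; have [N HN] := phiC _ e0.
  have Bmn m n : (N <= m)%N -> (N <= n)%N -> - e <= B (phi m) (phi n).
    move=> Nm Nn; have := HN m n Nm Nn.
    have := BB _ _ (cphi m) (cphi n).
    have := B0 _ (cphi m); have := B0 _ (cphi n).
    have cd : Cc_smooth Om (phi m \- phi n) by exact: Cc_sub.
    have : B (phi m \- phi n) (phi m \- phi n) <=
        ip Om (T (phi m \- phi n)) (phi m \- phi n).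
      by rewrite /B ipC lerBlDr lerDl mulr_ge0// ip_ge0.
    by rewrite -/(T _); lra.
  have Bu n : (N <= n)%N -> - e <= (mu - lam) * ip Om u (phi n).
    move=> Nn.
    have -> : (mu - lam) * ip Om u (phi n) = ip Om u (T (phi n)) - lam * ip Om u (phi n).
      by rewrite wu// ipZl// mulrBl.
    have c1 := ip_cvg lu lphi (L2_Cc (Cc_T (cphi n))) phiu.
    have c2 := ip_cvg lu lphi (lphi n) phiu.
    have c3 : ip Om (phi m) (T (phi n)) - lam * ip Om (phi m) (phi n)
        @[m --> \oo] --> ip Om u (T (phi n)) - lam * ip Om u (phi n).
      exact: (cvgB c1 (cvgM (cvg_cst lam) c2)).
    apply: (cvgr_to_ge c3).
    by exists N => // m Nm /=; exact: Bmn.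
  have c2 := ip_cvg lu lphi lu phiu.
  have c3 : (mu - lam) * ip Om (phi n) u @[n --> \oo] --> (mu - lam) * ip Om u u.
    exact: (cvgM (cvg_cst (mu - lam)) c2).
  apply: (cvgr_to_ge c3).
  by exists N => // n Nn /=; rewrite (ipC (phi n)); exact: Bu.
rewrite -subr_ge0 -(pmulr_lge0 _ u0) leNgt; apply/negP => neg.
have := key (- ((mu - lam) * ip Om u u) / 2); lra.
Qed.

(** * The eigenfunction *)

Hypothesis hb : forall s : seq 'I_3, (size s <= 2)%N ->
  exists M, forall x, Om x -> `|pderiv s h x| <= M.
Hypothesis hK : forall e, 0 < e -> compact [set x | Om x /\ e <= h x].
Hypothesis nOm : exists x, Om x.

(** A nonempty open set contains a box. *)
Lemma open_leb3_gt0 : (0 < leb3 Om)%E.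
Proof.
have [x Ox] := nOm.
have : nbhs x Om by apply: open_nbhs_nbhs; split.
move=> /nbhs_ballP[e /= e0 eO].
pose I (a : R) := [set` `]a - e, a + e[] : set R.
have mI a : measurable (I a : set mR) by exact: measurable_itv.
have lI a : (@lebesgue_measure R (I a) = (2 * e)%:E)%E.
  rewrite /I lebesgue_measure_itv/= lte_fin ifT; last by lra.
  by rewrite -EFinD; congr EFin; ring.
pose B : set mR3 := I x.1.1 `*` I x.1.2 `*` I x.2.
have mB : measurable B.
  by apply: measurableX; [apply: measurableX; exact: mI|exact: mI].
have lB : leb3 B = ((2 * e) * (2 * e) * (2 * e))%:E.
  rewrite /leb3 /= product_measure1E/=; [|by apply: measurableX; exact: mI|exact: mI].
  rewrite product_measure1E/=; [|exact: mI|exact: mI].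
  by rewrite !lI -!EFinM.
apply: (@lt_le_trans _ _ (leb3 B)).
  by rewrite lB lte_fin !mulr_gt0.
apply: le_measure; rewrite ?inE//.
move=> y [[]] /=; rewrite /I /= !in_itv/= => y1 y2 y3; apply: eO.
by split; [split|]; rewrite /= /ball/= ltr_norml; lra.
Qed.

Lemma h_not_ae0 : ~ {ae leb3, forall x, Om x -> h x = 0}.
Proof.
move=> [N [mN N0 NP]].
have := open_leb3_gt0; rewrite ltNge => /negP; apply.
rewrite -N0; apply: le_measure; rewrite ?inE//.
move=> x Ox; apply: NP => /= /(_ Ox) hx.
by have := h0 Ox; rewrite hx ltxx.
Qed.

Lemma bmeas_h s : (size s <= 2)%N -> bounded_measurable (pderiv s h).
Proof.
move=> s2; have [M hM] := hb s2; exact: (bmeas_smooth (smooth_on_pderiv s sh) hM).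
Qed.

(** The test functions that approximate [h]: they vanish where h < 1/(n+1) and
    are close to [h] where n h is large. *)
Definition happrox (n : nat) (x : R3) : R :=
  if `[< Om x >] then h x * cutoff (n.+1%:R * h x - 1) else 0.

Lemma smooth_on_happrox n : smooth_on Om (happrox n).
Proof.
have sa : smooth_on Om (fun x => n.+1%:R * h x + - 1).
  exact: (smooth_on_add oOm (smooth_on_scale _ oOm sh) (smooth_on_cst Om _)).
have sc := smooth_on_comp oOm smooth1_cutoff (fun _ _ => I) sa.
apply: smooth_on_eq oOm _ (smooth_on_mul oOm sh sc).
by move=> x Ox; rewrite /happrox asboolT.
Qed.

Lemma Cc_happrox n : Cc_smooth Om (happrox n).
Proof.
apply: Cc_local; first exact: smooth_on_happrox.
exists [set x | Om x /\ n.+1%:R^-1 <= h x]; split.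
- by apply: hK; rewrite invr_gt0.
- by move=> x [].
move=> x xK; rewrite /happrox; case: asboolP => // Ox.
rewrite cutoff0 ?mulr0//; rewrite subr_le0 leNgt; apply/negP => hx.
apply: xK; split => //; rewrite -div1r ler_pdivrMr// mulrC; exact: ltW.
Qed.

Lemma derive_happrox n i x : Om x -> 'D_(e3 i) (happrox n) x =
  'D_(e3 i) h x * (cutoff (n.+1%:R * h x - 1) +
    (n.+1%:R * h x - 1 + 1) * dcutoff (n.+1%:R * h x - 1)).
Proof.
move=> Ox; have dh := derivableP (smooth_on_derivable (i := i) sh Ox).
pose a := fun y => n.+1%:R * h y - 1.
have da : is_derive x (e3 i) a (n.+1%:R * 'D_(e3 i) h x).
  have d1 := is_deriveB (is_deriveZ n.+1%:R dh) (is_derive_cst (1 : R) x (e3 i)).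
  by rewrite subr0 in d1.
have dc := is_derive_chain (is_derive_cutoff (a x)) da.
have dp := is_deriveM dh dc.
have -> : 'D_(e3 i) (happrox n) x = 'D_(e3 i) (h * (cutoff \o a)) x.
  apply: near_eq_derive; apply: (open_near oOm Ox) => y Oy.
  by rewrite /happrox asboolT.
have [_ ->] := dp; rewrite -![_ *: _]/(_ * _) /= /a.
have alg (N H c d D : R) : H * (d * (N * D)) + c * D = D * (c + (N * H - 1 + 1) * d).
  by ring.
exact: alg.
Qed.

Lemma cutoff_cvg (g : R -> R) (t : R) : 0 < t ->
  (forall s, 1 <= s -> `|g s| <= 3 / s) ->
  g (n.+1%:R * t - 1) @[n --> \oo] --> 0.
Proof.
move=> t0 gs; apply/cvgrPdist_lt => e e0.
(* n.+1 > (2 + 3 / e) / t ensures both n.+1 t - 1 >= 1 and 3 / (n.+1 t - 1) < e *)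
have d0 : 0 < t / (2 + 3 / e) by rewrite divr_gt0// addr_gt0// divr_gt0.
have [N _ NP] := near_infty_natSinv_lt (PosNum d0).
exists N => // n Nn /=; rewrite sub0r normrN.
have := NP n Nn; rewrite /= => nP.
have n0 : 0 < n.+1%:R :> R by rewrite ltr0n.
have e3 : 0 < 3 / e by rewrite divr_gt0.
have big : 2 + 3 / e < n.+1%:R * t.
  move: nP; rewrite ltr_pdivlMr; last lra.
  by rewrite ltr_pdivrMl.
have s1 : 1 <= n.+1%:R * t - 1 by lra.
apply: le_lt_trans (gs _ s1) _.
rewrite ltr_pdivrMr; last lra.
have : 3 / e < n.+1%:R * t - 1 by lra.
by rewrite ltr_pdivrMr// mulrC.
Qed.

(** Dominated convergence with a constant bound, the domain having finite
    measure. *)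
Lemma dominated_ip (w : nat -> R3 -> R) (M : R) :
  (forall n, bounded_measurable (w n)) -> (forall n x, Om x -> `|w n x| <= M) ->
  (forall x, Om x -> w n x @[n --> \oo] --> 0) ->
  ip Om (w n) (w n) @[n --> \oo] --> 0.
Proof.
move=> bw wM w0.
have mw n : measurable_fun (Om : set mR3) (fun x => (w n x * w n x)%:E).
  by apply/measurable_EFinP; have [] := bmeas_mul (bw n) (bw n).
have iM : leb3.-integrable Om (EFin \o (fun _ : R3 => M * M)).
  by apply: bmeas_integrable; exact: bmeas_cst.
have c0 x : Om x -> (w n x * w n x)%:E @[n --> \oo] --> 0%:E.
  move=> Ox; apply: cvg_EFin; first by near=> n.
  rewrite -(mulr0 (0 : R)).
  exact: (cvgM (w0 x Ox) (w0 x Ox)).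
have := @dominated_cvg _ _ _ leb3 Om mOm (fun n x => (w n x * w n x)%:E)
  (fun _ => 0%:E) (EFin \o (fun _ : R3 => M * M)) mw c0.
move=> /(_ (fun _ _ => isT) iM) dc.
have : (\int[leb3]_(x in Om) (w n x * w n x)%:E @[n --> \oo] -->
    \int[leb3]_(x in Om) 0%:E)%E.
  apply: dc => n x Ox /=.
  by rewrite lee_fin normrM ler_pM// wM.
rewrite integral0 => /fine_cvg.
exact.
Unshelve. all: by end_near. Qed.

Lemma happrox_cvg : ip Om (h \- happrox n) (h \- happrox n) @[n --> \oo] --> 0.
Proof.
have [M hM] := hb (isT : (size [::] <= 2)%N).
have bh : bounded_measurable h := bmeas_h (isT : (size [::] <= 2)%N).
have E n x : Om x -> (h \- happrox n) x = h x * (1 - cutoff (n.+1%:R * h x - 1)).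
  by move=> Ox; rewrite /= /happrox asboolT// mulrBr mulr1.
apply: (@dominated_ip _ (M * 5)).
- by move=> n; exact: (bmeas_sub bh (bmeas_Cc (Cc_happrox n))).
- move=> n x Ox; rewrite E// normrM ler_pM//; first exact: hM.
  by have [] := cutoff_bounded (n.+1%:R * h x - 1).
- move=> x Ox; under eq_fun do rewrite E//.
  rewrite -(mulr0 (h x)); apply: cvgM; first exact: cvg_cst.
  apply: (@cutoff_cvg (fun s => 1 - cutoff s)); first exact: h0.
  by move=> s s1; have [] := cutoff_tail s1.
Qed.

Lemma derive_happrox_cvg i :
  ip Om ('D_(e3 i) h \- 'D_(e3 i) (happrox n))
        ('D_(e3 i) h \- 'D_(e3 i) (happrox n)) @[n --> \oo] --> 0.
Proof.
have [M hM] := hb (isT : (size [:: i] <= 2)%N).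
have bh : bounded_measurable ('D_(e3 i) h) := bmeas_h (isT : (size [:: i] <= 2)%N).
pose g (s : R) := 1 - (cutoff s + (s + 1) * dcutoff s).
have E n x : Om x -> ('D_(e3 i) h \- 'D_(e3 i) (happrox n)) x =
    'D_(e3 i) h x * g (n.+1%:R * h x - 1).
  by move=> Ox; rewrite /= derive_happrox// /g mulrBr mulr1.
apply: (@dominated_ip _ (M * 5)).
- by move=> n; exact: (bmeas_sub bh (bmeas_Cc (Cc_D i (Cc_happrox n)))).
- move=> n x Ox; rewrite E// normrM ler_pM//; first exact: hM.
  by have [] := cutoff_bounded (n.+1%:R * h x - 1).
- move=> x Ox; under eq_fun do rewrite E//.
  rewrite -(mulr0 ('D_(e3 i) h x)); apply: cvgM; first exact: cvg_cst.
  apply: (@cutoff_cvg g); first exact: h0.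
  by move=> s s1; have [] := cutoff_tail s1.
Qed.

Lemma h_happrox_near (e : R) : 0 < e -> exists N : nat, forall n, (N <= n)%N ->
  ip Om (h \- happrox n) (h \- happrox n) < e /\
  forall i, ip Om ('D_(e3 i) h \- 'D_(e3 i) (happrox n))
                  ('D_(e3 i) h \- 'D_(e3 i) (happrox n)) < e.
Proof.
move=> e0.
have N_of (a : nat -> R) : (forall n, 0 <= a n) -> a n @[n --> \oo] --> 0 ->
    exists N : nat, forall n, (N <= n)%N -> a n < e.
  move=> a0 /cvgr0Pnorm_lt /(_ e e0)[N _ NP]; exists N => n Nn.
  by have := NP n Nn; rewrite /= ger0_norm.
have [N HN] := N_of _ (fun n => ip_ge0 _) happrox_cvg.
have /boolp.choice[N' HN'] : forall i : 'I_3, exists N' : nat, forall n, (N' <= n)%N ->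
    ip Om ('D_(e3 i) h \- 'D_(e3 i) (happrox n))
          ('D_(e3 i) h \- 'D_(e3 i) (happrox n)) < e.
  by move=> i; exact: N_of _ (fun n => ip_ge0 _) (derive_happrox_cvg i).
exists (maxn N (\max_(i < 3) N' i)) => n; rewrite geq_max => /andP[Nn N'n].
split; first exact: HN.
by move=> i; apply: HN'; apply: leq_trans N'n; exact: leq_bigmax.
Qed.

(** The weak derivatives are the classical ones. Two integrations by parts
    exchange the order of the indices. *)
Lemma weak_pderiv_h s : (size s <= 2)%N ->
  exists2 g, L2 Om g & weak_pderiv Om s h g.
Proof.
case: s => [|i [|j [|//]]] _.
- exists h; first exact: (bmeas_L2 (bmeas_h (isT : (size [::] <= 2)%N))).
  by move=> phi _; rewrite expr0 mul1r.
- exists ('D_(e3 i) h); first exact: (bmeas_L2 (bmeas_h (isT : (size [:: i] <= 2)%N))).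
  by move=> phi cphi; rewrite expr1 mulN1r; exact: (Cc_ibp i sh cphi).
- exists ('D_(e3 j) ('D_(e3 i) h)).
    exact: (bmeas_L2 (bmeas_h (isT : (size [:: j; i] <= 2)%N))).
  move=> phi cphi; rewrite sqrrN expr1n mul1r.
  rewrite -[LHS]/(ip Om h ('D_(e3 i) ('D_(e3 j) phi))).
  by rewrite (Cc_ibp i sh (Cc_D j cphi)) (Cc_ibp j (smooth_on_D i sh) cphi) opprK.
Qed.

Lemma W2_h : W2 Om 2 h.
Proof.
split; first exact: (bmeas_L2 (bmeas_h (isT : (size [::] <= 2)%N))).
by move=> s; exact: weak_pderiv_h.
Qed.

Lemma W2o1_h : W2o1 Om h.
Proof.
split; first exact: (bmeas_L2 (bmeas_h (isT : (size [::] <= 2)%N))).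
exists (fun i => 'D_(e3 i) h); split => [i|e e0].
  split; first exact: (bmeas_L2 (bmeas_h (isT : (size [:: i] <= 2)%N))).
  by move=> phi cphi; rewrite expr1 mulN1r; exact: (Cc_ibp i sh cphi).
have [N /(_ N (leqnn N))[HN0 HNi]] := h_happrox_near (divr_gt0 e0 (ltr0n R 4)).
exists (happrox N); first exact: Cc_happrox.
apply: (@le_lt_trans _ _ (ip Om (h \- happrox N) (h \- happrox N) +
    \sum_(i < 3) e / 4)).
  by rewrite lerD2l; apply: ler_sum => i _; exact: ltW.
by rewrite sumr_const card_ord -mulr_natl; lra.
Qed.

Lemma ip_sub_le u v : L2 Om u -> L2 Om v ->
  ip Om (u \- v) (u \- v) <= 2 * ip Om u u + 2 * ip Om v v.
Proof.
move=> lu lv; rewrite (ip_sub_sub lu lv lu lv) (ipC v u).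
have := ip_young ltr01 lu lv; rewrite divr1 mul1r ler_norml => /andP[+ _].
move: (ip Om u u) (ip Om v v) (ip Om u v) => a b c; lra.
Qed.

(** The weak equation is two integrations by parts. The approximating sequence
    is Cauchy for the energy because its gradients converge in L2. *)
Lemma eigenvalue_lam : eigenvalue_laplacian Om lam.
Proof.
have bh : bounded_measurable h := bmeas_h (isT : (size [::] <= 2)%N).
have lh := bmeas_L2 bh.
exists h; split; first exact: h_not_ae0.
split; [exact: W2o1_h|exact: W2_h|split => //].
- exact: L2_scale.
- move=> v cv; rewrite (Cc_ipT sh cv).
  transitivity (\sum_(i < 3) - ip Om ('D_(e3 i) ('D_(e3 i) h)) v).
    by apply: eq_bigr => i _; exact: (Cc_ibp i (smooth_on_D i sh) cv).
  have cDD i : Cc_smooth Om (fun x => 'D_(e3 i) ('D_(e3 i) h) x * v x).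
    exact: (Cc_mul (smooth_on_D i (smooth_on_D i sh)) cv).
  rewrite sumrN -(Cc_int_sum _ cDD) -mulN1r -(RintegralZl (-1) mOm); last first.
    by apply: Cc_integrable; exact: Cc_sum.
  apply: eq_Rintegral => x; rewrite inE => Ox.
  rewrite -mulr_suml -/(laplacian h x) lap_h//.
  by move: (h x) (v x) => a b; ring.
exists happrox; split.
- exact: Cc_happrox.
- rewrite (_ : (fun n => _) = fun n => ip Om (h \- happrox n) (h \- happrox n)).
    exact: happrox_cvg.
  apply/funext => n; apply: eq_Rintegral => x _ /=.
  by move: (h x) (happrox n x) => a b; ring.
(* the energy of the difference is at most 3 (2 e / 16 + 2 e / 16) < e *)
move=> e e0; have alg (a b c : R) : a < e / 16 -> b < e / 16 -> c <= 2 * b + 2 * a -> c <= e / 4.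
  by move=> *; lra.
have e16 : 0 < e / 16 by rewrite divr_gt0.
have [N HN] := h_happrox_near e16.
exists N => m n Nm Nn; have cm := Cc_happrox m; have cn := Cc_happrox n.
have cd := Cc_sub cm cn.
rewrite (ipC (fun x => - _)) (Cc_ipT (Cc_smooth_on Om cd) cd).
apply: (@le_lt_trans _ _ (\sum_(i < 3) e / 4)); last first.
  by rewrite sumr_const card_ord -mulr_natl; lra.
apply: ler_sum => i _.
have [_ /(_ i) Hm] := HN m Nm; have [_ /(_ i) Hn] := HN n Nn.
have lDh : L2 Om ('D_(e3 i) h) by exact: (bmeas_L2 (bmeas_h (isT : (size [:: i] <= 2)%N))).
have lm := L2_sub lDh (L2_Cc (Cc_D i cm)); have ln := L2_sub lDh (L2_Cc (Cc_D i cn)).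
have hmn := ip_sub_le ln lm.
apply: le_trans (alg _ _ _ Hm Hn hmn); rewrite le_eqVlt; apply/orP; left; apply/eqP.
have sm := Cc_smooth_on setT cm; have sn := Cc_smooth_on setT cn.
have E x : 'D_(e3 i) (happrox m \- happrox n) x =
  (('D_(e3 i) h \- 'D_(e3 i) (happrox n)) \- ('D_(e3 i) h \- 'D_(e3 i) (happrox m))) x.
  rewrite (deriveB (smooth_on_derivable (i := i) sm I) (smooth_on_derivable (i := i) sn I)) /=.
  have alg2 (a b c : R) : b - c = a - c - (a - b) by ring.
  exact: alg2.
by apply: eq_ip => x _; exact: E.
Qed.

Theorem first_eigenvalue_of_positive : first_eigenvalue_laplacian Om lam.
Proof. by split; [exact: eigenvalue_lam|exact: eigenvalue_ge]. Qed.

End test_functions.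

(** * Radial eigenfunctions *)

Section radial.
Context {R : realType}.
Local Notation R3 := (R * R * R)%type.
Local Notation sqnorm := (@sqnorm R).

Definition dot (x v : R3) : R := x.1.1 * v.1.1 + x.1.2 * v.1.2 + x.2 * v.2.

Lemma is_derive_sqnorm (x v : R3) : is_derive x v sqnorm (2 * dot x v).
Proof.
have d1 := is_derive_coord1 x v; have d2 := is_derive_coord2 x v.
have d3 := is_derive_coord3 x v.
have := is_deriveD (is_deriveD (is_deriveM d1 d1) (is_deriveM d2 d2)) (is_deriveM d3 d3).
have -> : ((fun y : R3 => y.1.1) * (fun y : R3 => y.1.1) +
  (fun y : R3 => y.1.2) * (fun y : R3 => y.1.2) +
  (fun y : R3 => y.2) * (fun y : R3 => y.2)) = sqnorm.
  by apply/funext => y; rewrite /sqnorm !expr2.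
move=> dd; apply: is_derive_eq dd _.
by rewrite -![_ *: _]/(_ * _) /dot; ring.
Qed.

Lemma is_derive_dot (x v : R3) : is_derive x v (dot^~ v) (dot v v).
Proof.
have d1 := is_derive_coord1 x v; have d2 := is_derive_coord2 x v.
have d3 := is_derive_coord3 x v.
have := is_deriveD (is_deriveD (is_deriveZ v.1.1 d1) (is_deriveZ v.1.2 d2))
  (is_deriveZ v.2 d3).
have -> : (v.1.1 *: (fun y : R3 => y.1.1) + v.1.2 *: (fun y : R3 => y.1.2) +
  v.2 *: (fun y : R3 => y.2)) = dot^~ v.
  apply/funext => y; rewrite /dot.
  rewrite -[LHS]/(v.1.1 * y.1.1 + v.1.2 * y.1.2 + v.2 * y.2); ring.
move=> dd; apply: is_derive_eq dd _.
by rewrite -![_ *: _]/(_ * _) /dot.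
Qed.

Lemma sqnorm_continuous : continuous sqnorm.
Proof.
move=> x; apply: (smooth_on_continuous (smooth_on_sqnorm (@openT _)) I).
Qed.

Lemma sqnorm_open (V : set R) : open V -> open [set x | V (sqnorm x)].
Proof. by move=> oV; apply: open_comp => // x _; exact: sqnorm_continuous. Qed.

Lemma sqnorm_ge0 x : 0 <= sqnorm x.
Proof. by rewrite /sqnorm !addr_ge0 ?sqr_ge0. Qed.

Lemma sqnorm_le_box (x : R3) : sqnorm x <= 1 ->
  [/\ -1 <= x.1.1 <= 1, -1 <= x.1.2 <= 1 & -1 <= x.2 <= 1].
Proof.
rewrite /sqnorm; move: (x.1.1) (x.1.2) (x.2) => a b c h.
have := sqr_ge0 a; have := sqr_ge0 b; have := sqr_ge0 c => c2 b2 a2.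
by split; rewrite -ler_norml -(@expr_le1 _ 2)// real_normK ?num_real//; lra.
Qed.

(** The domain is b < |x|^2 < 1 and the eigenfunction is g(|x|^2). Taking b < 0
    gives the unit ball; then [g] has to be smooth up to and across 0, and no
    boundary condition is imposed at the inner end. *)
Variables (b : R) (V : set R) (g g1 g2 : R -> R) (lam : R).
Hypothesis oV : open V.
Hypothesis b1 : b < 1.
Hypothesis VJ : forall q, 0 <= q -> b <= q -> q <= 1 -> V q.
Hypothesis lam0 : 0 <= lam.
Hypothesis sg : smooth_on [set x | V (sqnorm x)] (g \o sqnorm).
Hypothesis dg : forall q : R, V q -> is_derive q 1 g (g1 q).
Hypothesis dg1 : forall q : R, V q -> is_derive q 1 g1 (g2 q).
Hypothesis gpos : forall q, 0 <= q -> b < q < 1 -> 0 < g q.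
Hypothesis ode : forall q, 0 <= q -> b < q < 1 ->
  4 * q * g2 q + 6 * g1 q = - lam * g q.
Hypothesis g_1 : g 1 = 0.
Hypothesis g_b : 0 <= b -> g b = 0.

Let Om : set R3 := [set x | b < sqnorm x < 1].
Let U : set R3 := [set x | V (sqnorm x)].
Let h : R3 -> R := g \o sqnorm.

Let oU : open U. Proof. exact: sqnorm_open. Qed.

Let oOm : open Om.
Proof.
rewrite (_ : Om = [set x | [set` `]b, 1[] (sqnorm x)]).
  by apply: sqnorm_open; exact: interval_open.
by apply/seteqP; split => x /=; rewrite in_itv.
Qed.

Let OmU : Om `<=` U.
Proof.
move=> x /= /andP[bx x1]; rewrite /U /=.
by apply: VJ; [exact: sqnorm_ge0|exact: ltW|exact: ltW].
Qed.

Let Kb : set R3 := [set x | b <= sqnorm x <= 1].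

Let KbU : Kb `<=` U.
Proof. by move=> x /= /andP[bx x1]; apply: VJ => //; exact: sqnorm_ge0. Qed.

Let closedKb : closed Kb.
Proof.
rewrite (_ : Kb = sqnorm @^-1` [set` `[b, 1]]).
  by apply: closed_comp => [x _|]; [exact: sqnorm_continuous|exact: interval_closed].
by apply/seteqP; split => x /=; rewrite in_itv.
Qed.

Let cube : set R3 := [set` `[-1, 1 : R]] `*` [set` `[-1, 1 : R]] `*` [set` `[-1, 1 : R]].

Let compact_cube : compact cube.
Proof.
by apply: compact_setX; [apply: compact_setX|]; exact: segment_compact.
Qed.

Let Kb_cube : Kb `<=` cube.
Proof.
move=> x /= /andP[_ /sqnorm_le_box[x1 x2 x3]].
by rewrite /cube /= !in_itv/=.
Qed.

Let compactKb : compact Kb.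
Proof. exact: subclosed_compact closedKb compact_cube Kb_cube. Qed.

Let sh : smooth_on Om h. Proof. exact: smooth_on_sub OmU sg. Qed.

Let hb (s : seq 'I_3) : exists M, forall x, Om x -> `|pderiv s h x| <= M.
Proof.
have c : {within Kb, continuous (pderiv s h)}.
  apply: continuous_in_subspaceT => x; rewrite inE => /KbU Ux.
  exact: (smooth_on_continuous (smooth_on_pderiv s sg) Ux).
have /compact_bounded[M [_ MP]] := continuous_compact c compactKb.
exists (M + 1) => x /= /andP[bx x1]; apply: (MP (M + 1)); first by rewrite ltrDl.
by exists x => //; rewrite /Kb /= !ltW.
Qed.

Let h0 x : Om x -> 0 < h x.
Proof. by move=> Ox; apply: gpos => //; exact: sqnorm_ge0. Qed.

(** A limit point of the superlevel set lies in the closed shell, where [h] is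
    still continuous; as h = 0 < e on the boundary, it is in the domain. *)
Let hK e : 0 < e -> compact [set x | Om x /\ e <= h x].
Proof.
move=> e0; apply: subclosed_compact compactKb _; last first.
  by move=> x [/andP[bx x1] _]; rewrite /Kb /= !ltW.
move=> p clp.
have Kp : Kb p.
  apply: closedKb => B /clp[y [[/andP[by_ y1] _] By]].
  by exists y; split => //; rewrite /Kb /= !ltW.
have ep : e <= h p.
  rewrite leNgt; apply/negP => hpe.
  have cp : {for p, continuous h} := smooth_on_continuous sg (KbU Kp).
  have : \forall y \near p, h y < e.
    by apply: (cp [set t | t < e]); apply: open_nbhs_nbhs; split => //; exact: open_lt.
  by move=> /clp[y [[_ ey] /= ye]]; move: (le_lt_trans ey ye); rewrite ltxx.
split => //; move: Kp => /= /andP[bp p1]; rewrite /Om /=.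
have np (q : R) : g q = 0 -> sqnorm p != q.
  move=> gq; apply/eqP => pq; move: ep; rewrite /h /= pq gq leNgt e0 //.
rewrite !lt_neqAle bp p1 !andbT np// andbT eq_sym.
have [b0|b0] := leP 0 b; first by rewrite np// g_b.
by rewrite gt_eqF// (lt_le_trans b0) ?sqnorm_ge0.
Qed.

(** For a vector v, the second derivative of g(|x|^2) along v is
    4 g''(|x|^2) <x, v>^2 + 2 g'(|x|^2) <v, v>. *)
Lemma laplacian_radial x : U x ->
  laplacian h x = 4 * sqnorm x * g2 (sqnorm x) + 6 * g1 (sqnorm x).
Proof.
move=> Ux.
have D1 v y : U y -> is_derive y v h (g1 (sqnorm y) * (2 * dot y v)).
  by move=> Uy; apply: is_derive_chain; [exact: dg|exact: is_derive_sqnorm].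
have D2 v : 'D_v ('D_v h) x =
    g2 (sqnorm x) * (2 * dot x v) ^+ 2 + 2 * g1 (sqnorm x) * dot v v.
  have -> : 'D_v ('D_v h) x = 'D_v ((g1 \o sqnorm) * (2 *: dot^~ v)) x.
    apply: near_eq_derive; apply: (open_near oU Ux) => y Uy.
    by have [_ ->] := D1 v y Uy.
  have e1 := is_derive_chain (dg1 Ux) (is_derive_sqnorm x v).
  have e2 := is_deriveZ 2 (is_derive_dot x v).
  have [_ ->] := is_deriveM e1 e2.
  rewrite -![_ *: _]/(_ * _) /=.
  have alg (a c d1 d2 : R) : a * (2 * d2) + 2 * d1 * (c * (2 * d1)) =
    c * (2 * d1) ^+ 2 + 2 * a * d2 by ring.
  exact: alg.
transitivity (\sum_(i < 3) (g2 (sqnorm x) * (2 * dot x (e3 i)) ^+ 2 +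
    2 * g1 (sqnorm x) * dot (e3 i) (e3 i))).
  by apply: eq_bigr => i _; exact: D2.
move: (g1 _) (g2 _) => a c; rewrite !big_ord_recl big_ord0 /dot /e3 /sqnorm /=.
by move: (x.1.1) (x.1.2) (x.2) => x1 x2 x3; ring.
Qed.

Theorem radial_first_eigenvalue : first_eigenvalue_laplacian Om lam.
Proof.
apply: (@first_eigenvalue_of_positive _ _ oOm 2 _ _ h) => //.
- move=> x /= /andP[_ /ltW/sqnorm_le_box[x1 x2 x3]].
  by rewrite /box /= !in_itv/=; split; [split|]; lra.
- move=> x Ox; rewrite laplacian_radial; last exact: OmU.
  by apply: ode => //; exact: sqnorm_ge0.
(* a point whose squared norm is halfway between max b 0 and 1 *)
- pose q := (Num.max b 0 + 1) / 2.
  have m0 : 0 <= Num.max b 0 by rewrite le_max lexx orbT.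
  have mb : b <= Num.max b 0 by rewrite le_max lexx.
  have m1 : Num.max b 0 < 1 by rewrite gt_max b1 ltr01.
  exists (Num.sqrt q, 0, 0); rewrite /Om /= /sqnorm /= expr0n !addr0 sqr_sqrtr.
    by rewrite /q; apply/andP; split; lra.
  by rewrite /q; lra.
Qed.

End radial.

(** * The annulus *)

Section profile.
Context {R : realType}.
Variables k s : R.

(** The function sin (k (r - s)) / r of q = r^2, and its first two derivatives
    in q. *)
Definition profile (q : R) : R := sin (k * (Num.sqrt q - s)) * (Num.sqrt q)^-1.

Definition profile1 (q : R) : R :=
  let w := (Num.sqrt q)^-1 in
  k / 2 * (cos (k * (Num.sqrt q - s)) * w ^+ 2)
  - 1 / 2 * (sin (k * (Num.sqrt q - s)) * w ^+ 3).

Definition profile2 (q : R) : R :=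
  let w := (Num.sqrt q)^-1 in
  - (k ^+ 2 / 4) * (sin (k * (Num.sqrt q - s)) * w ^+ 3)
  - (k * 3 / 4) * (cos (k * (Num.sqrt q - s)) * w ^+ 4)
  + 3 / 4 * (sin (k * (Num.sqrt q - s)) * w ^+ 5).

Section derivatives.
Variable q : R.
Hypothesis q0 : 0 < q.
Let r := Num.sqrt q.
Let w := r^-1.

Let r0 : r != 0. Proof. by rewrite gt_eqF// sqrtr_gt0. Qed.

Let dr : is_derive q 1 Num.sqrt (w / 2).
Proof.
have := is_derive1_sqrt q0; rewrite invfM mulrC; exact.
Qed.

Let dw : is_derive q 1 (fun q => (Num.sqrt q)^-1) (- (w ^+ 3 / 2)).
Proof.
have := is_deriveV r0 dr => d; apply: is_derive_eq d _.
rewrite -[_ *: _]/(_ * _) -/r /w.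
by field.
Qed.

Let da : is_derive q 1 (fun q => k * (Num.sqrt q - s)) (k * (w / 2)).
Proof.
have := is_deriveZ k (is_deriveB dr (is_derive_cst s q (1:R))) => d.
by apply: is_derive_eq d _; rewrite -[_ *: _]/(_ * _) subr0.
Qed.

Let dsin : is_derive q 1 (fun q => sin (k * (Num.sqrt q - s)))
  (cos (k * (r - s)) * (k * (w / 2))).
Proof. exact: (@is_derive1_comp _ sin (fun q => k * (Num.sqrt q - s)) q _ _ (is_derive_sin _) da). Qed.

Let dcos : is_derive q 1 (fun q => cos (k * (Num.sqrt q - s)))
  (- sin (k * (r - s)) * (k * (w / 2))).
Proof. exact: (@is_derive1_comp _ cos (fun q => k * (Num.sqrt q - s)) q _ _ (is_derive_cos _) da). Qed.

Lemma is_derive_profile : is_derive q 1 profile (profile1 q).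
Proof.
have d := is_deriveM dsin dw; apply: is_derive_eq d _.
rewrite -![_ *: _]/(_ * _) /profile1 -/r -/w.
by move: (sin _) (cos _) => S C; field.
Qed.

Lemma is_derive_profile1 : is_derive q 1 profile1 (profile2 q).
Proof.
pose C (t : R) := cos (k * (Num.sqrt t - s)).
pose S (t : R) := sin (k * (Num.sqrt t - s)).
pose W (t : R) := (Num.sqrt t)^-1.
have -> : profile1 = (k / 2) *: (C * W ^+ 2) - (1 / 2) *: (S * W ^+ 3) by [].
have d := is_deriveB (is_deriveZ (k / 2) (is_deriveM dcos (is_deriveX 2 dw)))
  (is_deriveZ (1 / 2) (is_deriveM dsin (is_deriveX 3 dw))).
apply: is_derive_eq d _.
rewrite -![_ *: _]/(_ * _) /profile2 /= -/r -/w.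
rewrite -[(_ ^+ 2) q]/(w ^+ 2) -[(_ ^+ 3) q]/(w ^+ 3).
by move: (sin _) (cos _) => S' C'; field.
Qed.

End derivatives.

Lemma profile_ode (q : R) : 0 < q ->
  4 * q * profile2 q + 6 * profile1 q = - k ^+ 2 * profile q.
Proof.
move=> q0; rewrite /profile /profile1 /profile2.
have r0 : Num.sqrt q != 0 by rewrite gt_eqF// sqrtr_gt0.
rewrite -[X in 4 * X](sqr_sqrtr (ltW q0)).
by move: r0 (sin _) (cos _); move: (Num.sqrt q) => r r0 S C; field.
Qed.

(** A composition of smooth functions away from the origin. *)
Lemma smooth_on_profile :
  smooth_on [set x : R * R * R | 0 < sqnorm x] (profile \o @sqnorm R).
Proof.
have oU : open [set x : R * R * R | 0 < sqnorm x].
  exact: (sqnorm_open (@open_gt R 0)).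
set U := [set x | _] in oU *.
have sq : smooth_on U (@sqnorm R) by exact: smooth_on_sqnorm.
have sr : smooth_on U (fun x => Num.sqrt (sqnorm x)).
  apply: (@smooth_on_eq _ _ ((fun t : R => t `^ 2^-1) \o @sqnorm R) _ oU).
    by move=> x /ltW x0 /=; rewrite powR12_sqrt.
  exact: (smooth_on_comp oU (smooth1_powR 2^-1) (fun _ => id) sq).
have sw : smooth_on U (fun x => (Num.sqrt (sqnorm x))^-1).
  apply: (@smooth_on_eq _ _ ((fun t : R => t `^ (- 2^-1)) \o @sqnorm R) _ oU).
    by move=> x /ltW x0 /=; rewrite powRN powR12_sqrt.
  exact: (smooth_on_comp oU (smooth1_powR (- 2^-1)) (fun _ => id) sq).
have s1 : smooth1 setT (@sin R).
  (* a shift by a quarter period differentiates the sine *)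
  exists (fun n t => sin (t + n%:R * (pi / 2))); split.
    by apply/funext => t; rewrite mul0r addr0.
  move=> n t _; have d : is_derive t 1 (fun t : R => t + n%:R * (pi / 2)) 1.
    by apply: is_derive_eq; rewrite addr0.
  have := @is_derive1_comp _ sin (fun t : R => t + n%:R * (pi / 2)) t _ _ (is_derive_sin _) d.
  rewrite mulr1; suff -> : cos (t + n%:R * (pi / 2)) = sin (t + n.+1%:R * (pi / 2)) by [].
  by rewrite -sinDpihalf; congr sin; rewrite -[n.+1%:R]natr1; ring.
have sa : smooth_on U (fun x => k * (Num.sqrt (sqnorm x) + - s)).
  exact: (smooth_on_scale k oU (smooth_on_add oU sr (smooth_on_cst U (- s)))).
exact: (smooth_on_mul oU (smooth_on_comp oU s1 (fun _ _ => I) sa) sw).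
Qed.

End profile.

Section annulus.
Context {R : realType}.

Lemma enorm_lt1 (x : R * R * R) : (enorm x < 1) = (sqnorm x < 1).
Proof. by rewrite /enorm -/(sqnorm x) -{1}(sqrtr1 R) ltr_sqrt. Qed.

Lemma enorm_gt (t : R) (x : R * R * R) : 0 <= t -> (t < enorm x) = (t ^+ 2 < sqnorm x).
Proof.
move=> t0; rewrite -[in RHS](sqr_sqrtr (sqnorm_ge0 x)).
by rewrite (@ltr_pXn2r _ 2)// nnegrE// sqrtr_ge0.
Qed.

(** The choice k = pi / (1 - s) makes the profile vanish at both ends; it is
    positive in between because k (r - s) runs through the interval from 0 to pi. *)
Theorem first_eigenvalue_annulus (s : R) : 0 < s < 1 ->
  first_eigenvalue_laplacian (annulus3 s) ((pi / (1 - s)) ^+ 2).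
Proof.
move=> /andP[s0 s1]; set k := pi / (1 - s).
have p0 := pi_gt0 R.
have k0 : 0 < k by apply: divr_gt0 => //; lra.
have ks : k * (1 - s) = pi by rewrite /k divfK// gt_eqF//; lra.
have -> : annulus3 s = [set x | s ^+ 2 < sqnorm x < 1].
  by apply/seteqP; split => x; rewrite /annulus3 /= (enorm_gt _ (ltW s0)) enorm_lt1.
have s20 : 0 < s ^+ 2 by rewrite exprn_gt0.
apply: (@radial_first_eigenvalue _ (s ^+ 2) [set t | 0 < t]
  (profile k s) (profile1 k s) (profile2 k s)).
- exact: open_gt.
- by rewrite expr_lt1// ltW.
- by move=> q _ sq _ /=; lra.
- exact: sqr_ge0.
- exact: smooth_on_profile.
- by move=> q q0; exact: is_derive_profile.
- by move=> q q0; exact: is_derive_profile1.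
- move=> q q0 /andP[sq q1]; have q0' : 0 < q by lra.
  apply: mulr_gt0; last by rewrite invr_gt0 sqrtr_gt0.
  have sr : s < Num.sqrt q.
    by rewrite -(ltr_pXn2r (n := 2))// ?nnegrE ?sqrtr_ge0 ?(ltW s0)// sqr_sqrtr.
  have r1 : Num.sqrt q < 1 by rewrite -{1}(sqrtr1 R) ltr_sqrt.
  by apply: sin_gt0_pi; rewrite -ks mulr_gt0 ?subr_gt0// ltr_pM2l// ltrD2r.
- by move=> q q0 /andP[sq q1]; apply: profile_ode; lra.
- by rewrite /profile sqrtr1 ks sinpi mul0r.
- by move=> _; rewrite /profile sqrtr_sqr gtr0_norm// subrr mulr0 sin0 mul0r.
Qed.

End annulus.

(** * The ball *)

Section entire.
Context {R : realType}.

(** Coefficients bounded like those of A exp (B x). The class is stable under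
    differentiation of the series, and such series converge everywhere. *)
Definition exp_bounded (c : nat -> R) := exists A B : R,
  [/\ 0 <= A, 0 <= B & forall n, `|c n| <= A * (B ^+ n / n`!%:R)].

Lemma exp_bounded_diffs c : exp_bounded c -> exp_bounded (pseries_diffs c).
Proof.
move=> [A [B [A0 B0 cAB]]]; exists (A * B), B; split => // [|n].
  exact: mulr_ge0.
rewrite /pseries_diffs normrM ger0_norm//.
apply: le_trans (ler_wpM2l (ler0n _ _) (cAB n.+1)) _.
rewrite factS natrM exprS invfM.
have n0 : n.+1%:R != 0 :> R by rewrite pnatr_eq0.
have f0 : n`!%:R != 0 :> R by rewrite pnatr_eq0 -lt0n fact_gt0.
rewrite le_eqVlt; apply/orP; left; apply/eqP.
by move: n0 f0 (B ^+ n); move: (n.+1%:R) (n`!%:R) => a f a0 f0 Bn; field; rewrite a0 f0.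
Qed.

Lemma exp_bounded_cvg c x : exp_bounded c -> cvgn (pseries c x).
Proof.
move=> [A [B [A0 B0 cAB]]]; apply: normed_cvg.
apply: (@series_le_cvg _ _ (A *: exp_coeff (B * `|x|))).
- by move=> n /=; exact: normr_ge0.
- move=> n; rewrite -[_ n]/(A * ((B * `|x|) ^+ n / n`!%:R)).
  by rewrite mulr_ge0// divr_ge0// exprn_ge0// mulr_ge0.
- move=> n /=; rewrite -[leRHS]/(A * ((B * `|x|) ^+ n / n`!%:R)).
  rewrite normrM normrX exprMn mulrAC mulrA.
  by rewrite ler_wpM2r ?exprn_ge0.
- by apply: is_cvg_seriesZ; exact: is_cvg_series_exp_coeff.
Qed.

Lemma smooth1_pseries c : exp_bounded c ->
  smooth1 setT (fun x => limn (pseries c x)).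
Proof.
move=> bc; exists (fun n x => limn (pseries (iter n (@pseries_diffs R) c) x)).
split => // n x _.
have bn m : exp_bounded (iter m (@pseries_diffs R) c).
  by elim: m => //= m; exact: exp_bounded_diffs.
apply: (@pseries_snd_diffs _ _ (`|x| + 1)).
- exact/exp_bounded_cvg/bn.
- exact/exp_bounded_cvg/(bn n.+1).
- exact/exp_bounded_cvg/(bn n.+2).
- by rewrite [ltRHS]ger0_norm ?addr_ge0// ltrDl.
Qed.

Lemma pseries0 (c : nat -> R) : limn (pseries c 0) = c 0%N.
Proof.
apply/cvg_lim => //; apply/cvg_ballP => e e0; exists 1%N => // -[//|n] _ /=.
rewrite /pseries /series /= big_nat_recl// expr0 mulr1 big1 ?addr0.
  exact: ballxx.
by move=> i _; rewrite expr0n mulr0.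
Qed.

(** The Taylor coefficients of sin (pi r) / r in powers of r^2. *)
Definition sinc_coef (n : nat) : R :=
  (-1) ^+ n * pi ^+ n.*2.+1 / n.*2.+1`!%:R.

Lemma sinc_coef_bounded : exp_bounded sinc_coef.
Proof.
have p0 := pi_gt0 R; exists pi, (pi ^+ 2); split => [||n].
- exact: ltW.
- exact: sqr_ge0.
rewrite /sinc_coef normrM normrM normrX normrN1 expr1n mul1r.
rewrite ger0_norm ?exprn_ge0 ?(ltW p0)// normfV ger0_norm// -exprM mul2n exprS.
rewrite -mulrA ler_wpM2l ?(ltW p0)// ler_wpM2l ?exprn_ge0 ?(ltW p0)//.
rewrite lef_pV2 ?posrE ?ltr0n ?fact_gt0// ler_nat leq_fact//.
by rewrite -addnn; apply: leq_trans (leq_addr _ _) (leqnSn _).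
Qed.

Definition sinc (q : R) : R := limn (pseries sinc_coef q).

Lemma sinc_profile (q : R) : 0 < q -> sinc q = profile pi 0 q.
Proof.
move=> q0; set r := Num.sqrt q; have r0 : r != 0 by rewrite gt_eqF// sqrtr_gt0.
rewrite /profile subr0 -/r -[LHS](mulfK r0); congr (_ * _).
have -> : sin (pi * r) = limn (series (sin_coeff' (pi * r))).
  by apply/esym/cvg_lim => //; exact: cvg_sin_coeff'.
have -> : series (sin_coeff' (pi * r)) = (fun n => pseries sinc_coef q n * r).
  apply/funext => n; rewrite /pseries /series /= mulr_suml.
  apply: eq_bigr => i _; rewrite /sin_coeff' /sinc_coef -exprnP.
  rewrite -[in q ^+ i](sqr_sqrtr (ltW q0)) -/r -exprM mul2n exprMn exprS.
  by rewrite [r ^+ _.+1]exprS; move: (_%:R^-1) => a; ring.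
rewrite /sinc; apply/esym/cvg_lim => //.
have c := exp_bounded_cvg (x := q) sinc_coef_bounded; exact: (cvgM c (cvg_cst r)).
Qed.

Lemma ball3E : ball3 = [set x : R * R * R | -1 < sqnorm x < 1].
Proof.
apply/seteqP; split => x; rewrite /ball3 /= enorm_lt1.
  by move=> ->; rewrite andbT (lt_le_trans _ (sqnorm_ge0 x)).
by case/andP.
Qed.

(** Off the origin [sinc] is the profile of the annulus with inner radius 0, so
    the differential equation is already known there; at the origin it only
    relates the first two Taylor coefficients. *)
Theorem first_eigenvalue_ball : first_eigenvalue_laplacian (@ball3 R) (pi ^+ 2).
Proof.
have p0 := pi_gt0 R.
have [D [D0 dD]] := smooth1_pseries sinc_coef_bounded.
have sD : D 0%N = sinc by rewrite D0.
have c0 : sinc 0 = pi.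
  by rewrite /sinc pseries0 /sinc_coef expr0 mul1r expr1 divr1.
(* at the origin the equation reads 6 D1 = - pi^2 D0 *)
have c1 : D 1%N 0 = - pi ^+ 3 / 6.
  have bc := exp_bounded_diffs sinc_coef_bounded.
  have d := @pseries_snd_diffs _ sinc_coef 1 0
    (exp_bounded_cvg sinc_coef_bounded) (exp_bounded_cvg bc)
    (exp_bounded_cvg (exp_bounded_diffs bc)).
  have := d _; rewrite normr0 normr1 => /(_ ltr01) [_ d1].
  have [_ d2] := dD 0%N 0 I; rewrite -d2 D0 d1 pseries0.
  by rewrite /pseries_diffs /sinc_coef mul1r expr1 mulN1r.
have near_pos (q : R) (q0 : 0 < q) (F G : R -> R) : (forall t, 0 < t -> F t = G t) ->
    \forall t \near q, F t = G t.
  by move=> FG; exact: filterS FG (lt_nbhsr q0).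
have D1E q : 0 < q -> D 1%N q = profile1 pi 0 q.
  move=> q0; have [_ <-] := is_derive_profile pi 0 q0.
  have [_ <-] := dD 0%N q I; apply: near_eq_derive; apply: near_pos q0 _ _ _.
  by move=> t t0; rewrite sD sinc_profile.
have D2E q : 0 < q -> D 2%N q = profile2 pi 0 q.
  move=> q0; have [_ <-] := is_derive_profile1 pi 0 q0.
  have [_ <-] := dD 1%N q I; apply: near_eq_derive; apply: near_pos q0 _ _ _.
  by move=> t t0; exact: D1E.
rewrite ball3E.
apply: (@radial_first_eigenvalue _ (-1) setT sinc (D 1%N) (D 2%N)) => //.
- exact: openT.
- exact: sqr_ge0.
- apply: (smooth_on_comp (V := setT)) => //.
  + exact: sqnorm_open openT.
  + by exists D.
  + apply: smooth_on_sqnorm; exact: sqnorm_open openT.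
- by move=> q _; rewrite -sD; exact: dD.
- move=> q; rewrite le_eqVlt => /predU1P[<- _|q0 /andP[_ q1]]; first by rewrite c0.
  rewrite sinc_profile// /profile subr0 mulr_gt0 ?invr_gt0 ?sqrtr_gt0//.
  have r1 : Num.sqrt q < 1 by rewrite -{1}(sqrtr1 R) ltr_sqrt.
  by apply: sin_gt0_pi; rewrite mulr_gt0 ?sqrtr_gt0//= -{2}[pi]mulr1 ltr_pM2l.
- move=> q; rewrite le_eqVlt => /predU1P[<- _|q0 _].
    by rewrite c0 c1; field.
  by rewrite D1E// D2E// sinc_profile//; exact: profile_ode.
- by rewrite sinc_profile// /profile subr0 sqrtr1 mulr1 sinpi mul0r.
- by rewrite oppr_ge0 ler10.
Qed.

End entire.

(** * The limit *)

Lemma first_eigenvalue_unique (R : realType) (Om : set (R * R * R)) (l m : R) :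
  first_eigenvalue_laplacian Om l -> first_eigenvalue_laplacian Om m -> l = m.
Proof.
by move=> [el lmin] [em mmin]; apply/eqP; rewrite eq_le lmin// mmin.
Qed.

Theorem mainTheorem4 (R : realType) (lambda1 : R -> R) (lambda1o : R)
    (hlambda1 : forall sigma : R, 0 < sigma < 1 ->
      first_eigenvalue_laplacian (annulus3 sigma) (lambda1 sigma))
    (hlambda1o : first_eigenvalue_laplacian ball3 lambda1o) :
  lambda1 sigma @[sigma --> 0^'+] --> lambda1o.
Proof.
rewrite (first_eigenvalue_unique hlambda1o (@first_eigenvalue_ball R)).
have lim : (pi / (1 - sigma)) ^+ 2 @[sigma --> (0 : R)^'+] --> (pi : R) ^+ 2.
  have c : pi / (1 - sigma) @[sigma --> (0 : R)] --> (pi / (1 - 0) : R).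
    apply: cvgM; first exact: cvg_cst.
    apply: cvgV; first by rewrite subr0 oner_eq0.
    by apply: cvgB; [exact: cvg_cst|exact: cvg_id].
  rewrite subr0 divr1 in c.
  apply: (@cvg_at_right_filter _ _ (fun sigma => (pi / (1 - sigma)) ^+ 2)).
  exact: (cvgM c c).
apply: cvg_trans lim; apply: near_eq_cvg; near=> sigma.
apply: first_eigenvalue_unique (first_eigenvalue_annulus _) (hlambda1 _ _).
  by apply/andP; split; near: sigma; [exact: nbhs_right_gt|exact: nbhs_right_lt].
by apply/andP; split; near: sigma; [exact: nbhs_right_gt|exact: nbhs_right_lt].
Unshelve. all: by end_near. Qed.
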